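(* Let $\vec G$ be an orientation of the Coxeter diagram $s_1-s_2-\cdots-s_{n-1}$ of $S_n$, and let $Q(\vec G)$ be a polygon as described below. Then the Cambrian lattice $\mathcal C(\vec G)$ is isomorphic to the partial order on the triangulations of $Q(\vec G)$ whose cover relations are the diagonal flips, where going up in a cover relation corresponds to increasing the slope of the flipped diagonal (i.e. $T\lessdot T'$ iff $T'$ is obtained from $T$ by replacing a diagonal $d$ by a diagonal $d'$ with the slope of $d'$ greater than the slope of $d$).
   Context: Weak order on $S_n$: $x\le y$ iff $I(x)\subseteq I(y)$, $I(x)=\{(x_j,x_i):i<j,x_i>x_j\}$; $s_i=(i,i+1)$. The Cambrian congruence $\Theta(\vec G)$ is the smallest lattice congruence of the weak order with $t\equiv ts$ for every directed edge $s\to t$ of $\vec G$; $\mathcal C(\vec G)$ is the weak order modulo $\Theta(\vec G)$. Define a partition $[n]=U\sqcup D$ by: for $b\in[2,n-1]$, $b\in U$ if the edge is directed $s_b\to s_{b-1}$ and $b\in D$ if $s_{b-1}\to s_b$; the indices $1$ and $n$ are placed in $U$ or $D$ arbitrarily. $Q(\vec G)$ is a convex polygon in $\mathbb R^2$ with vertices $v_0,\dots,v_{n+1}$ whose $x$-coordinates strictly increase with index, with $v_0,v_{n+1}$ on the $x$-axis, $v_i$ above the axis for $i\in U$ and below for $i\in D$; slopes are measured in these coordinates. A diagonal is a segment between non-adjacent vertices; a triangulation is a maximal set of pairwise non-crossing diagonals; a diagonal flip removes one diagonal and inserts the other diagonal of the resulting quadrilateral. *)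

(* Defs.v *)
From HB Require Import structures.
From mathcomp Require Import all_boot all_order all_algebra all_fingroup.
From mathcomp Require Import reals.
From Stdlib Require Import Relations.
Unset Printing Implicit Defensive.
Import Order.TTheory GRing.Theory Num.Theory.
Local Open Scope ring_scope.

(* Weak order on S_n.  Elements of 'S_n permute 'I_n = {0,..,n-1}   *)
(* (0-based version of [n]); x i is the one-line entry x_{i+1}.     *)

Definition inv_set (n : nat) (x : 'S_n) : {set 'I_n * 'I_n} :=
  [set p : 'I_n * 'I_n | [exists i : 'I_n, exists j : 'I_n,
      [&& (i < j)%N, (x j < x i)%N & p == (x j, x i)]]].

Definition weak_le (n : nat) (x y : 'S_n) : Prop := inv_set n x \subset inv_set n y.

Definition is_meet (n : nat) (m x y : 'S_n) : Prop :=
  [/\ weak_le n m x, weak_le n m y &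
      forall w, weak_le n w x -> weak_le n w y -> weak_le n w m].
Definition is_join (n : nat) (j x y : 'S_n) : Prop :=
  [/\ weak_le n x j, weak_le n y j &
      forall w, weak_le n x w -> weak_le n y w -> weak_le n j w].

Definition lattice_congruence (n : nat) (th : 'S_n -> 'S_n -> Prop) : Prop :=
  [/\ (forall x, th x x),
      (forall x y, th x y -> th y x),
      (forall x y z, th x y -> th y z -> th x z),
      (forall x y z m m', th x y -> is_meet n m x z -> is_meet n m' y z -> th m m') &
      (forall x y z j j', th x y -> is_join n j x z -> is_join n j' y z -> th j j')].

(* s_a = (a, a+1) (1-based values), acting on 0-based values k.      *)
Definition sw (a k : nat) : nat :=
  if k == a.-1 then a else if k == a then a.-1 else k.

(* t = s_a and y = t s = s_a s_c (product as composition:            *)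
(* (t s)(k) = t (s k)), in one-line notation.                        *)
Definition is_t_ts (n a c : nat) (t y : 'S_n) : Prop :=
  forall k : 'I_n, nat_of_ord (t k) = sw a k /\ nat_of_ord (y k) = sw a (sw c k).

(* The orientation of s_1 - ... - s_{n-1} is encoded by U : nat -> bool, *)
(* "b \in U" iff U b (for b in [1,n]; D is the complement).  For      *)
(* b in [2,n-1]: U b  <-> edge s_b -> s_{b-1};                        *)
(*               ~~ U b <-> edge s_{b-1} -> s_b.                      *)
(* Generating pairs t == ts for each directed edge s -> t.            *)
Definition camb_gen (n : nat) (U : nat -> bool) (x y : 'S_n) : Prop :=
  exists b : nat, [/\ (2 <= b)%N, (b <= n.-1)%N &
    (U b /\ is_t_ts n b.-1 b x y) \/ (~~ U b /\ is_t_ts n b b.-1 x y)].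

Definition cambrian_cong (n : nat) (U : nat -> bool) (x y : 'S_n) : Prop :=
  forall th : 'S_n -> 'S_n -> Prop, lattice_congruence n th ->
    (forall a b, camb_gen n U a b -> th a b) -> th x y.

Definition cambrian_le (n : nat) (U : nat -> bool) (x y : 'S_n) : Prop :=
  exists x' y', [/\ cambrian_cong n U x x', cambrian_cong n U y y' & weak_le n x' y'].

Definition on_up (n : nat) (U : nat -> bool) (k : nat) : bool :=
  [|| k == 0%N, k == n.+1 | U k].
Definition on_down (n : nat) (U : nat -> bool) (k : nat) : bool :=
  [|| k == 0%N, k == n.+1 | ~~ U k].

Definition adjacent (n : nat) (U : nat -> bool) (i j : 'I_n.+2) : bool :=
  (i < j)%N &&
  ( (on_up n U i && on_up n U j &&
      [forall k : 'I_n.+2, ~~ [&& (i < k)%N, (k < j)%N & on_up n U k]])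
  || (on_down n U i && on_down n U j &&
      [forall k : 'I_n.+2, ~~ [&& (i < k)%N, (k < j)%N & on_down n U k]])).

Section Geom.
Variable R : realType.

Definition orient (a b c : R * R) : R :=
  (b.1 - a.1) * (c.2 - a.2) - (b.2 - a.2) * (c.1 - a.1).

Definition is_Q (n : nat) (U : nat -> bool) (v : 'I_n.+2 -> R * R) : Prop :=
  [/\ (forall i j : 'I_n.+2, (i < j)%N -> (v i).1 < (v j).1),
      (forall i : 'I_n.+2, nat_of_ord i = 0%N -> (v i).2 = 0),
      (forall i : 'I_n.+2, nat_of_ord i = n.+1 -> (v i).2 = 0),
      (forall i : 'I_n.+2, (1 <= i <= n)%N ->
          (U i -> 0 < (v i).2) /\ (~~ U i -> (v i).2 < 0)) &
      (* strict convexity: for every polygon edge, all other vertices lie *)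
      (* strictly on one common side of its supporting line               *)
      (forall i j k l : 'I_n.+2, adjacent n U i j ->
          k != i -> k != j -> l != i -> l != j ->
          0 < orient (v i) (v j) (v k) * orient (v i) (v j) (v l))].

Definition is_diag (n : nat) (U : nat -> bool) (d : 'I_n.+2 * 'I_n.+2) : bool :=
  (d.1 < d.2)%N && ~~ adjacent n U d.1 d.2.

Definition cross (n : nat) (v : 'I_n.+2 -> R * R) (d e : 'I_n.+2 * 'I_n.+2) : Prop :=
  exists t s : R, [/\ 0 < t < 1, 0 < s < 1,
    (1 - t) * (v d.1).1 + t * (v d.2).1 = (1 - s) * (v e.1).1 + s * (v e.2).1 &
    (1 - t) * (v d.1).2 + t * (v d.2).2 = (1 - s) * (v e.1).2 + s * (v e.2).2].

Definition is_triang (n : nat) (U : nat -> bool) (v : 'I_n.+2 -> R * R)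
    (T : {set 'I_n.+2 * 'I_n.+2}) : Prop :=
  [/\ (forall d, d \in T -> is_diag n U d),
      (forall d e, d \in T -> e \in T -> d != e -> ~ cross n v d e) &
      (forall d, is_diag n U d -> d \notin T -> exists2 e, e \in T & cross n v d e)].

Definition slope (n : nat) (v : 'I_n.+2 -> R * R) (i j : 'I_n.+2) : R :=
  ((v j).2 - (v i).2) / ((v j).1 - (v i).1).

Definition linked (n : nat) (U : nat -> bool) (T : {set 'I_n.+2 * 'I_n.+2})
    (a b : 'I_n.+2) : bool :=
  ((a < b)%N && (adjacent n U a b || ((a, b) \in T))) ||
  ((b < a)%N && (adjacent n U b a || ((b, a) \in T))).

(* Upward flip: remove the diagonal ac of T; the two triangles abc, aec *)
(* of T containing it form a quadrilateral; insert its other diagonal   *)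
(* be, whose slope is greater than that of ac.                          *)
Definition up_flip (n : nat) (U : nat -> bool) (v : 'I_n.+2 -> R * R)
    (T T' : {set 'I_n.+2 * 'I_n.+2}) : Prop :=
  exists a c b e : 'I_n.+2,
    [/\ (a, c) \in T, (a < c)%N && (b < e)%N,
        [&& linked n U T a b, linked n U T b c, linked n U T a e & linked n U T e c],
        T' = (T :\ (a, c)) :|: [set (b, e)] &
        slope n v a c < slope n v b e].

Definition flip_le (n : nat) (U : nat -> bool) (v : 'I_n.+2 -> R * R) :
    relation {set 'I_n.+2 * 'I_n.+2} :=
  clos_refl_trans _ (up_flip n U v).

Definition flip_cover (n : nat) (U : nat -> bool) (v : 'I_n.+2 -> R * R)
    (T T' : {set 'I_n.+2 * 'I_n.+2}) : Prop :=
  [/\ flip_le n U v T T', T <> T' &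
      forall T'', flip_le n U v T T'' -> flip_le n U v T'' T' -> T'' = T \/ T'' = T'].

End Geom.

(* Main.v *)
Require Import Defs.
From Stdlib Require Import Relations.
From HB Require Import structures.
From mathcomp Require Import all_boot all_order all_algebra all_fingroup.
From mathcomp Require Import reals.
From mathcomp Require Import zify ring lra.
Import Order.TTheory GRing.Theory Num.Theory.
Set Implicit Arguments.
Unset Strict Implicit.

(** Reading the one-line notation of x from left to right, start with the
    lower boundary of the polygon and, at each letter k, insert the vertex k
    into the current lattice path if k is in U and delete it if k is in D.
    The edges of these paths triangulate the polygon, and this defines g.
    A segment d belongs to g x exactly when all labels "below" d (end points
    in U, inner vertices in D) precede in x all labels "above" d (end points
    in D, inner vertices in U); two segments cross exactly when these
    requirements contradict each other.

    Thus the fibre of a triangulation T is the set of linear extensions of the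
    relation "p is below and q above some diagonal of T".  Its transitive
    closure is acyclic and has the property that a label lying between two
    related labels is related to one of them, so that each fibre has a least
    and a greatest element in the weak order.  These depend monotonically on
    the permutation, hence the fibres form a lattice congruence.  It contains
    the generators of the Cambrian congruence; conversely two elements of a
    fibre are joined by covers ..ac.. < ..ca.. with some b between a and c
    that precedes them (b in U) or follows them (b in D), and all such covers
    are forced by the generators, by induction on c - a, using hexagons.

    Finally a cover of the weak order that is not contracted changes a single
    step of the lattice path, which is a flip increasing the slope, and every
    such flip arises in this way. *)

(** * The weak order *)

Section WeakOrder.
Variable n : nat.
Implicit Types (x y w : 'S_n) (p q a c : 'I_n).

Definition pos x p : nat := (x^-1)%g p.

Lemma pos_inj x : injective (pos x).
Proof. by move=> p q /val_inj/perm_inj. Qed.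

Lemma pos_neq x p q : p != q -> pos x p != pos x q.
Proof. by apply: contraNneq => /pos_inj->. Qed.

Lemma pos_lt x p : pos x p < n.
Proof. exact: ltn_ord. Qed.

Lemma pos_perm x i : pos x (x i) = i.
Proof. by rewrite /pos permK. Qed.

Lemma inv_setE x p q :
  ((p, q) \in inv_set n x) = (p < q) && (pos x q < pos x p).
Proof.
rewrite inE; apply/existsP/andP => [[i /existsP[j /and3P[ij xij /eqP[-> ->]]]]|[pq h]].
  by rewrite !pos_perm.
exists ((x^-1)%g q); apply/existsP; exists ((x^-1)%g p).
by rewrite !permKV h pq eqxx.
Qed.

Lemma weak_leP x y :
  weak_le n x y <->
  forall p q, p < q -> pos x q < pos x p -> pos y q < pos y p.
Proof.
split=> [/subsetP le p q pq h|h].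
  by have := le (p, q); rewrite !inv_setE pq h => /(_ isT).
by apply/subsetP => -[p q]; rewrite !inv_setE => /andP[pq /(h p q pq)->]; rewrite pq.
Qed.

Lemma weak_le_refl x : weak_le n x x.
Proof. exact: subxx. Qed.

Lemma weak_le_trans y x z : weak_le n x y -> weak_le n y z -> weak_le n x z.
Proof. exact: subset_trans. Qed.

Lemma pos_card x p : pos x p = #|[set q | pos x q < pos x p]|.
Proof.
have le : pos x p <= n by apply: ltnW; apply: pos_lt.
have -> : [set q | pos x q < pos x p] =
          [set x (widen_ord le i) | i in 'I_(pos x p)].
  apply/setP => q; rewrite inE; apply/idP/imsetP => [h|[i _ ->]].
    exists (Ordinal h) => //; apply: (@perm_inj _ (x^-1)%g).
    by rewrite permK; apply: val_inj.
  by rewrite pos_perm /= ltn_ord.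
rewrite card_imset ?card_ord // => i j /perm_inj/(congr1 val) h.
exact: val_inj.
Qed.

(** The number of [L]-predecessors is strictly increasing along [L], hence a bijection onto the
    positions. As [pos] reads the inverse permutation, the inverse of this rank map is taken. *)
Lemma perm_of_order (L : rel 'I_n) :
  irreflexive L -> transitive L -> (forall p q, p != q -> L p q || L q p) ->
  exists x : 'S_n, forall p q, (pos x p < pos x q) = L p q.
Proof.
move=> irr tr tot.
pose r p := #|[set q | L q p]|.
have rmono p q : L p q -> r p < r q.
  move=> pq; apply: proper_card; apply/properP; split.
    by apply/subsetP => s; rewrite !inE => /tr; apply.
  by exists p; rewrite inE ?irr.
have rE p q : (r p < r q) = L p q.
  have [->|ne] := eqVneq p q; first by rewrite ltnn irr.
  apply/idP/idP => [lt|/rmono//].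
  by case/orP: (tot p q ne) => // /rmono; lia.
have rlt p : r p < n.
  rewrite -[X in _ < X](card_ord n) -cardsT; apply: proper_card.
  by apply/properP; split; [apply: subsetT|exists p; rewrite inE ?irr].
have finj : injective (fun p => Ordinal (rlt p)).
  move=> p q /(congr1 val)/= e; apply/eqP; apply: contraT => ne.
  by case/orP: (tot p q ne) => /rmono; rewrite e ltnn.
exists ((perm finj)^-1)%g => p q.
by rewrite /pos invgK !permE /= rE.
Qed.

Lemma perm_of_rank (f : 'I_n -> nat) :
  injective f -> exists x : 'S_n, forall p q, (pos x p < pos x q) = (f p < f q).
Proof.
move=> finj; apply: perm_of_order => [p|q p r|p q ne].
- exact: ltnn.
- exact: ltn_trans.
- by rewrite -neq_ltn (inj_eq finj).
Qed.

Lemma pos_order_inj x y :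
  (forall p q, pos x p < pos x q -> pos y p < pos y q) -> x = y.
Proof.
move=> h.
have E p q : (pos x p < pos x q) = (pos y p < pos y q).
  apply/idP/idP => [/h//|lt].
  have [//|/h|/pos_inj e] := ltngtP (pos x p) (pos x q); first by lia.
  by move: lt; rewrite e ltnn.
apply: invg_inj; apply/permP => p; apply: val_inj.
change (pos x p = pos y p).
by rewrite pos_card [RHS]pos_card; apply: eq_card => q; rewrite !inE E.
Qed.

Lemma weak_le_anti x y : weak_le n x y -> weak_le n y x -> x = y.
Proof.
move=> /weak_leP xy /weak_leP yx; apply: pos_order_inj => p q.
case: (ltngtP p q) => [pq h|pq h|/val_inj->]; last by rewrite ltnn.
  have /(pos_neq y) ne : p != q by rewrite -val_eqE /=; lia.
  case: (ltngtP (pos y p) (pos y q)) => // [/(yx _ _ pq)|/eqP]; first by lia.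
  by rewrite (negbTE ne).
by apply: xy.
Qed.

(** Products act from left to right, so multiplying by [tperm a c] on the right exchanges the values
    [a] and [c] rather than two positions. *)
Lemma pos_swap x a c p : pos (x * tperm a c)%g p = pos x (tperm a c p).
Proof. by rewrite /pos invMg tpermV permM. Qed.

Lemma swap_order x a c p q :
  pos x c = (pos x a).+1 -> (p, q) != (a, c) -> (p, q) != (c, a) ->
  (pos (x * tperm a c)%g p < pos (x * tperm a c)%g q) = (pos x p < pos x q).
Proof.
move=> e n1 n2; rewrite !pos_swap.
have H u v : u <> v -> pos x u != pos x v by move/eqP/pos_neq.
case: (tpermP a c p) n1 n2 => [->|->|/H pa /H pc];
  case: (tpermP a c q) => [->|->|/H qa /H qc]; rewrite ?eqxx //; lia.
Qed.

Lemma inv_swap x a c : a < c -> pos x c = (pos x a).+1 ->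
  inv_set n (x * tperm a c)%g = (a, c) |: inv_set n x.
Proof.
move=> ac e; apply/setP => -[p q]; rewrite in_setU1 !inv_setE.
have [[-> ->]|n1] /= := eqVneq (p, q) (a, c).
  by rewrite !pos_swap tpermL tpermR ac e ltnSn.
have [[-> ->]|n2] := eqVneq (p, q) (c, a); first by lia.
by congr (_ && _); apply: swap_order => //;
  rewrite xpair_eqE andbC -xpair_eqE.
Qed.

(** An intersection of inversion sets need not be an inversion set, but when it is one, it gives the
    meet. *)
Lemma is_meet_setI m x y : inv_set n m = inv_set n x :&: inv_set n y ->
  is_meet n m x y.
Proof.
rewrite /is_meet /weak_le => ->; split; [exact: subsetIl|exact: subsetIr|].
by move=> w wx wy; rewrite subsetI wx.
Qed.

Lemma is_join_setU j x y : inv_set n j = inv_set n x :|: inv_set n y ->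
  is_join n j x y.
Proof.
rewrite /is_join /weak_le => ->; split; [exact: subsetUl|exact: subsetUr|].
by move=> w wx wy; rewrite subUset wx.
Qed.

(** This allows a step down from [x] by a cover while staying above [y]. Induct on the distance in
    [x] of an inversion [a], [c] missing from [y]: if the letter [m] right after [c] is not [a],
    then one of the pairs [a], [m] and [m], [c] is a closer inversion missing from [y]. *)
Lemma exists_descent x y : weak_le n y x -> x <> y ->
  exists a c, [/\ a < c, pos x a = (pos x c).+1 & (a, c) \notin inv_set n y].
Proof.
move=> yx ne.
have [[a c] /andP[acx acy]|no] :=
    pickP (fun d => (d \in inv_set n x) && (d \notin inv_set n y)); last first.
  case: ne; apply: weak_le_anti => //; apply/subsetP => d dx.
  by have := no d; rewrite dx /= => /negbFE.
move: acx; rewrite inv_setE => /andP[ac].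
have [k] := ubnP (pos x a - pos x c).
elim: k a c acy ac => // k IH a c acy ac lek lt.
have [e|ne'] := eqVneq (pos x a) (pos x c).+1; first by exists a, c.
have [m em] : exists m, pos x m = (pos x c).+1.
  have h : (pos x c).+1 < n by have := pos_lt x a; lia.
  by exists (x (Ordinal h)); rewrite pos_perm.
move: acy; rewrite inv_setE ac /= -leqNgt => acy.
have ma : m != a by apply: contraNneq ne' => <-; rewrite em.
have mc : m != c by apply/eqP => mc; move: em; rewrite mc; lia.
have := pos_neq y ma; have := pos_neq y mc => p1 p2.
move: ma mc; rewrite -!val_eqE /= => ma mc.
have K (u v : 'I_n) : u < v -> pos y v < pos y u -> pos x v < pos x u.
  by move=> uv; move/weak_leP: yx => /(_ u v uv).
case: (ltnP (pos y a) (pos y m)) => am.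
  have [lt1|lt2] := ltnP a m.
    by apply: (IH a m); rewrite ?inv_setE; lia.
  by have := K m a; lia.
have [lt1|lt2] := ltnP m c.
  by exists m, c; split=> //; rewrite inv_setE; lia.
by have := K c m; lia.
Qed.
End WeakOrder.

(** * Forcing among the covers of the weak order *)

Section Forcing.
Variables (n : nat) (th : 'S_n -> 'S_n -> Prop).
Hypothesis th_cong : lattice_congruence n th.
Implicit Types (x y w : 'S_n) (p q a c : 'I_n).

Lemma cong_refl x : th x x.
Proof. by case: th_cong. Qed.

Lemma cong_sym x y : th x y -> th y x.
Proof. by case: th_cong => _ h _ _ _; apply: h. Qed.

Lemma cong_trans y x z : th x y -> th y z -> th x z.
Proof. by case: th_cong => _ _ h _ _; apply: h. Qed.

Lemma cong_meet x y z m m' : th x y ->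
  inv_set n m = inv_set n x :&: inv_set n z ->
  inv_set n m' = inv_set n y :&: inv_set n z -> th m m'.
Proof.
move=> xy /is_meet_setI mm /is_meet_setI mm'.
by case: th_cong => _ _ _ h _; apply: h mm mm'.
Qed.

Lemma cong_join x y z j j' : th x y ->
  is_join n j x z -> is_join n j' y z -> th j j'.
Proof. by case: th_cong => _ _ _ _ h; apply: h. Qed.

Definition swap_at w a c := pos w c = (pos w a).+1 /\ a < c.

(** The top of the upper cover is the join of [w2] with the top of the lower one, and [w1] is the
    meet of [w2] with that same lower top. So joins carry a contraction up and meets carry it
    down. *)
Lemma perspective w1 w2 a c :
  weak_le n w1 w2 -> swap_at w1 a c -> swap_at w2 a c ->
  th w1 (w1 * tperm a c)%g <-> th w2 (w2 * tperm a c)%g.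
Proof.
move=> le [e1 ac] [e2 _].
have i1 := inv_swap ac e1; have i2 := inv_swap ac e2.
have n2 : (a, c) \notin inv_set n w2 by rewrite inv_setE; lia.
split=> h.
  apply: (cong_join (z := w2) h); apply: is_join_setU.
    by apply/esym/setUidPr.
  by rewrite i1 i2 -setUA; congr (_ |: _); apply/esym/setUidPr.
apply: (cong_meet (z := (w1 * tperm a c)%g) h).
  rewrite i1; apply/setP => d; rewrite in_setI in_setU1.
  have [->|_] /= := eqVneq d (a, c); last first.
    by apply/idP/andP => [dw|[]//]; split=> //; apply: (subsetP le) dw.
  by rewrite (negbTE n2); apply/negbTE; apply: contra n2; apply: (subsetP le).
rewrite i1 i2; apply/esym/setIidPr; exact: setUS.
Qed.

Lemma hexagon_forcing u (i j k : 'I_n) :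
  i < j -> j < k -> pos u j = (pos u i).+1 -> pos u k = (pos u j).+1 ->
  th u (u * tperm j k)%g \/ th u (u * tperm i j)%g ->
  th (u * tperm i j)%g (u * tperm i j * tperm i k)%g /\
  th (u * tperm j k)%g (u * tperm j k * tperm i k)%g.
Proof.
move=> ij jk eij ejk.
have ik : i < k by lia.
have nij : i != j by rewrite -val_eqE /=; lia.
have njk : j != k by rewrite -val_eqE /=; lia.
have nik : i != k by rewrite -val_eqE /=; lia.
(* The six permutations are named by the order in which they list i, j, k. *)
set jik := (u * tperm i j)%g; set ikj := (u * tperm j k)%g.
set jki := (jik * tperm i k)%g; set kij := (ikj * tperm i k)%g.
have Ijik : inv_set n jik = (i, j) |: inv_set n u by apply: inv_swap.
have Iikj : inv_set n ikj = (j, k) |: inv_set n u by apply: inv_swap.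
have Ijki : inv_set n jki = (i, k) |: inv_set n jik.
  apply: inv_swap => //; rewrite !pos_swap tpermL tpermD //; lia.
have Ikij : inv_set n kij = (i, k) |: inv_set n ikj.
  apply: inv_swap => //; rewrite !pos_swap tpermR tpermD 1?eq_sym //; lia.
pose kji := (jki * tperm j k)%g.
have Ikji : inv_set n kji = (j, k) |: inv_set n jki.
  apply: inv_swap => //.
  by rewrite !pos_swap tpermR (tpermD nij) ?tpermL ?tpermR // eq_sym.
have Nij : (i, j) \notin inv_set n u by rewrite inv_setE; lia.
have Njk : (j, k) \notin inv_set n u by rewrite inv_setE; lia.
have Nik : (i, k) \notin inv_set n u by rewrite inv_setE; lia.
have dij : (i, j) != (j, k) by rewrite xpair_eqE negb_and nij.
have dik : (i, j) != (i, k) by rewrite xpair_eqE negb_and njk orbT.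
have djk : (j, k) != (i, k) by rewrite xpair_eqE negb_and eq_sym nij.
(* The union of the two inversion sets lacks [(i, k)], so this join is not a union; but whatever
   inverts [(i, j)] and [(j, k)] also inverts [(i, k)]. *)
have top : is_join n kji jik ikj.
  split; rewrite /weak_le ?Ikji ?Ijki ?Iikj.
  - by rewrite setUA subsetUr.
  - by apply: setUS; rewrite Ijik setUA subsetUr.
  move=> w; rewrite Ijik !subUset !sub1set => /andP[wij ->] /andP[wjk _].
  rewrite wjk wij /= andbT.
  by move: wij wjk; rewrite !inv_setE; lia.
have top' : is_join n kji ikj jik by case: top => *; split; auto.
have selfL (x y : 'S_n) : inv_set n x \subset inv_set n y -> is_join n y x y.
  by move=> s; apply: is_join_setU; apply/esym/setUidPr.
have M1 : inv_set n u = inv_set n jik :&: inv_set n kij.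
  apply/setP => d; rewrite Ikij Ijik Iikj in_setI !in_setU1.
  case: (eqVneq d (i, j)) => [->|_]; last by case: (d \in _); rewrite ?orbT.
  by rewrite (negbTE dik) (negbTE dij) (negbTE Nij).
have M2 : inv_set n kij = inv_set n kji :&: inv_set n kij.
  by apply/esym/setIidPr; rewrite Ikji Ijki Ijik Ikij Iikj;
     rewrite !(setUCA [set (j, k)]) !setUS // subsetUr.
have M3 : inv_set n jki = inv_set n kji :&: inv_set n jki.
  by apply/esym/setIidPr; rewrite Ikji subsetUr.
have M4 : inv_set n jik = inv_set n jik :&: inv_set n jki.
  by apply/esym/setIidPl; rewrite Ijki subsetUr.
have M5 : inv_set n ikj = inv_set n ikj :&: inv_set n kij.
  by apply/esym/setIidPl; rewrite Ikij subsetUr.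
have M8 : inv_set n u = inv_set n ikj :&: inv_set n jki.
  apply/setP => d; rewrite Ijki Ijik Iikj in_setI !in_setU1.
  case: (eqVneq d (j, k)) => [->|_]; last by case: (d \in _); rewrite ?orbT.
  by rewrite (negbTE djk) eq_sym (negbTE dij) (negbTE Njk).
have uj : inv_set n u \subset inv_set n jik by rewrite Ijik subsetUr.
have uk : inv_set n u \subset inv_set n ikj by rewrite Iikj subsetUr.
(* Joining the contracted bottom edge with the other atom contracts that atom with the top [kji].
   Meets with [jki] and [kij] bring this down to the two side edges. *)
case=> h.
  have h1 : th jik kji := cong_join h (selfL _ _ uj) top'.
  split; first exact: cong_meet h1 M4 M3.
  apply: cong_trans (cong_sym h) _.
  exact: cong_meet h1 M1 M2.
have h1 : th ikj kji := cong_join h (selfL _ _ uk) top.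
split; last exact: cong_meet h1 M5 M2.
apply: cong_trans (cong_sym h) _.
exact: cong_meet h1 M8 M3.
Qed.
End Forcing.

Lemma pos_succ n (x : 'S_n) p q : pos x p < pos x q ->
  (forall v, pos x p < pos x v -> pos x v < pos x q -> False) ->
  pos x q = (pos x p).+1.
Proof.
move=> pq h; apply/eqP; rewrite eqn_leq pq andbT leqNgt; apply/negP => lt.
have lt' : (pos x p).+1 < n by apply: ltn_trans lt (pos_lt _ _).
apply: (h (x (Ordinal lt'))); rewrite pos_perm //=.
Qed.

(** The one-line notation lists the letters of [blk] sorted by [g], then [a c], then the remaining
    letters sorted by [g]. *)
Lemma block_perm n (blk : pred 'I_n) (g : 'I_n -> nat) (a c : 'I_n) :
  injective g -> (forall v, g v < n) -> a != c ->
  exists x : 'S_n, [/\ pos x c = (pos x a).+1,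
    forall v, v != a -> v != c -> blk v -> pos x v < pos x a,
    forall v, v != a -> v != c -> ~~ blk v -> pos x c < pos x v &
    forall u v, u != a -> u != c -> v != a -> v != c -> blk u = blk v ->
      (pos x u < pos x v) = (g u < g v)].
Proof.
move=> ginj gn ac.
(* As [g] stays below [n], the ranks [n] and [n.+1] come right after the block, and the shift by
   [n.+2] moves all other letters behind them. *)
pose f v := if v == a then n else if v == c then n.+1 else
  if blk v then g v else n.+2 + g v.
have fa : f a = n by rewrite /f eqxx.
have fc : f c = n.+1 by rewrite /f eqxx eq_sym (negbTE ac).
have fb v : v != a -> v != c -> blk v -> f v = g v.
  by rewrite /f => /negbTE-> /negbTE-> ->.
have fnb v : v != a -> v != c -> ~~ blk v -> f v = n.+2 + g v.
  by rewrite /f => /negbTE-> /negbTE-> /negbTE->.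
have [x xE] : exists x : 'S_n, forall p q, (pos x p < pos x q) = (f p < f q).
  have fP p : [\/ p = a, p = c, f p = g p | f p = n.+2 + g p].
    have [->|pa] := eqVneq p a; first by constructor 1.
    have [->|pc] := eqVneq p c; first by constructor 2.
    by case bp: (blk p); [constructor 3; rewrite fb|constructor 4; rewrite fnb ?bp].
  apply: perm_of_rank => p q.
  move: (gn p) (gn q) (@ginj p q) => gp gq gpq.
  case: (fP p) => [->|->|->|->]; case: (fP q) => [->|->|->|->];
    rewrite ?fa ?fc // => e; try (exfalso; clear -e gp gq; lia);
    apply: gpq; clear -e; lia.
exists x; split=> [|v va vc bv|v va vc bv|u v ua uc va vc buv].
- apply: pos_succ; first by rewrite xE fa fc.
  by move=> v; rewrite !xE fa fc; lia.
- by rewrite xE fa fb.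
- by rewrite xE fc fnb //; lia.
- rewrite xE; case bu : (blk u).
    by rewrite !fb // -buv.
  by rewrite !fnb ?ltn_add2l // -?buv bu.
Qed.

Lemma tperm_sw n (a b k : 'I_n) : b = a.+1 :> nat -> tperm a b k = sw b k :> nat.
Proof.
move=> ab; have ne (u v : 'I_n) : u <> v -> (u : nat) <> v by move=> uv /val_inj.
by rewrite /sw; case: tpermP => [->|->|/ne ka /ne kb]; repeat case: eqP => ?; lia.
Qed.

(** A generator is a cover exchanging adjacent letters [a c] with the only intermediate value [b] in
    front of them if it is in U and behind them otherwise. The 0-based value [b] carries the 1-based
    index [b.+1]. *)
Lemma camb_genP n U (x y : 'S_n) : camb_gen n U x y <->
  exists a b c : 'I_n, [/\ b = a.+1 :> nat, c = b.+1 :> nat,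
    x = (if U b.+1 then tperm a b else tperm b c) & y = (x * tperm a c)%g].
Proof.
have key (a b c : 'I_n) : b = a.+1 :> nat -> c = b.+1 :> nat ->
    (tperm a b * tperm a c = tperm b c * tperm a b)%g /\
    (tperm b c * tperm a c = tperm a b * tperm b c)%g.
  move=> ab bc.
  have nab : a != b by rewrite -val_eqE /=; lia.
  have nbc : b != c by rewrite -val_eqE /=; lia.
  have nac : a != c by rewrite -val_eqE /=; lia.
  split.
    have -> : tperm a c = (tperm b c ^ tperm a b)%g.
      by rewrite tpermJ tpermR (tpermD nac nbc).
    by rewrite conjgE tpermV !mulgA tperm2 mul1g.
  have -> : tperm a c = (tperm a b ^ tperm b c)%g.
    by rewrite tpermJ tpermL tpermD // eq_sym.
  by rewrite conjgE tpermV !mulgA tperm2 mul1g.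
split=> [[B [B2 Bn h]]|[a [b [c [ab bc -> ->]]]]].
  have an : B.-2 < n by lia.
  have bn : B.-1 < n by lia.
  have cn : B < n by lia.
  pose a := Ordinal an; pose b := Ordinal bn; pose c := Ordinal cn.
  have ab : b = a.+1 :> nat by rewrite /=; lia.
  have bc : c = b.+1 :> nat by rewrite /=; lia.
  have eB : b.+1 = B by rewrite /=; lia.
  have [eU eD] := key a b c ab bc.
  have xE : x = if U b.+1 then tperm a b else tperm b c.
    rewrite eB; apply/permP => k; apply: ord_inj.
    case: h => -[UB h]; rewrite ?UB ?(negbTE UB) (proj1 (h k)) /=.
      by rewrite (tperm_sw k ab).
    by rewrite (tperm_sw k bc).
  exists a, b, c; split=> //; apply/permP => k; apply: ord_inj.
  rewrite xE eB; case: h => -[UB h]; rewrite ?UB ?(negbTE UB) (proj2 (h k)) /=.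
    by rewrite eU permM (tperm_sw _ ab) (tperm_sw _ bc).
  by rewrite eD permM (tperm_sw _ bc) (tperm_sw _ ab).
have [eU eD] := key a b c ab bc.
exists b.+1; split; [by lia|by have := ltn_ord c; lia|].
case: (U _); [left|right]; split=> // k; split;
  rewrite ?eU ?eD ?permM ?(tperm_sw _ ab) ?(tperm_sw _ bc) ?bc //.
by rewrite (tperm_sw k ab).
Qed.

(** * Covers forced by the Cambrian generators *)

Section ForcingAll.
Variables (n : nat) (U : nat -> bool) (th : 'S_n -> 'S_n -> Prop).
Hypothesis th_cong : lattice_congruence n th.
Hypothesis th_gen : forall x y, camb_gen n U x y -> th x y.
Implicit Types (w : 'S_n) (a b c : 'I_n).

(** The bottom [t] of the generator has a single inversion, which [w] shares; hence [t] lies below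
    [w] and the two covers are perspective. *)
Lemma forcing_generator w a b c : swap_at w a c ->
  b = a.+1 :> nat -> c = b.+1 :> nat -> (pos w b < pos w a) = U b.+1 ->
  th w (w * tperm a c)%g.
Proof.
move=> sw_ac ab bc Ub.
have nab : a != b by rewrite -val_eqE /=; lia.
have nbc : b != c by rewrite -val_eqE /=; lia.
have nac : a != c by rewrite -val_eqE /=; lia.
pose t : 'S_n := if U b.+1 then tperm a b else tperm b c.
have tE p : pos t p = t p.
  by rewrite /pos /t; case: (U _); rewrite tpermV.
have st : swap_at t a c.
  split; last by lia.
  rewrite !tE /t; case: (U _); first by rewrite tpermL tpermD //.
  by rewrite tpermR tpermD 1?eq_sym.
have le : weak_le n t w.
  have ne (u v : 'I_n) : u <> v -> (u : nat) <> (v : nat) by move=> uv /val_inj.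
  have [e _] := sw_ac; have := pos_neq w nab; have := pos_neq w nbc => k1 k2.
  apply/weak_leP => p q pq; rewrite !tE /t; move: pq; case UB: (U _) Ub => Ub;
  case: tpermP => [->|->|/ne qa /ne qb]; case: tpermP => [->|->|/ne pa /ne pb];
    move=> pq; rewrite ?ltnn; lia.
apply: (proj1 (perspective th_cong le st sw_ac)).
by apply/th_gen/camb_genP; exists a, b, c.
Qed.

(* The blocks below describe the largest and the smallest permutation having *)
(* the same cover label as w: a descending, resp. ascending, arrangement of  *)
(* the values before and after the adjacent pair a c.                        *)
Lemma forcing w a b c : swap_at w a c -> a < b -> b < c ->
  (pos w b < pos w a) = U b.+1 -> th w (w * tperm a c)%g.
Proof.
have [k] := ubnP (c - a); elim: k w a b c => // k IH w a b c lek sw_ac ab bc Ub.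
have ne (u v : 'I_n) : u != v -> (u : nat) <> (v : nat) by move=> /eqP uv /val_inj.
have nac : a != c by rewrite -val_eqE /=; lia.
have nba : b != a by rewrite -val_eqE /=; lia.
have nbc : b != c by rewrite -val_eqE /=; lia.
have [ewac ac] := sw_ac.
pose R (v : 'I_n) := (a < v < c) && (pos w v < pos w a).
have wR (v : 'I_n) : v != a -> v != c -> (pos w v < pos w a) \/ (pos w c < pos w v).
  by move=> /(pos_neq w) h1 /(pos_neq w) h2; lia.
(* Values between [a] and [c] keep the side of the pair that they have in [w]. Values above [c] go
   in front of it in [M] and behind it in [J]; values below [a] go the other way. *)
pose blkM (v : 'I_n) := (c < v) || R v; pose blkJ (v : 'I_n) := (v < a) || R v.
pose gM (v : 'I_n) := n.-1 - v.
have ginj : injective gM.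
  move=> u v; rewrite /gM => e; apply: val_inj => /=.
  by have := ltn_ord u; have := ltn_ord v; lia.
have gM_lt v : gM v < n by rewrite /gM; have := ltn_ord v; lia.
have gME (u v : 'I_n) : (gM u < gM v) = (v < u).
  by rewrite /gM; have := ltn_ord u; have := ltn_ord v; lia.
have [M [eM M1 M2 M3]] := block_perm blkM ginj gM_lt nac.
have [J [eJ J1 J2 J3]] := block_perm blkJ val_inj (@ltn_ord n) nac.
have sM : swap_at M a c by [].
have sJ : swap_at J a c by [].
have wM : weak_le n w M.
  apply/weak_leP => p q pq h.
  have [pa|pa] := eqVneq p a.
    subst p; have [qc|qc] := eqVneq q c; first by subst q; lia.
    have qa : q != a by rewrite -val_eqE /=; lia.
    by apply: M1 => //; rewrite /blkM /R; case: (ltnP c q) => //=; have := ne _ _ qc; lia.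
  have [qa|qa] := eqVneq q a.
    subst q; have pc : p != c by rewrite -val_eqE /=; lia.
    have := M2 p pa pc; rewrite /blkM /R; lia.
  have [qc|qc] := eqVneq q c.
    subst q; have pc : p != c by rewrite -val_eqE /=; lia.
    have := M2 p pa pc; rewrite /blkM /R.
    have := wR _ pa pc; lia.
  have [pc|pc] := eqVneq p c.
    by subst p; have := M1 q qa qc; rewrite /blkM; lia.
  have := M3 q p qa qc pa pc; rewrite gME pq.
  have := M1 q qa qc; have := M2 p pa pc; have := wR q qa qc; have := wR p pa pc.
  have := ne _ _ qa; have := ne _ _ qc; have := ne _ _ pa; have := ne _ _ pc.
  rewrite /blkM /R; lia.
have Jw : weak_le n J w.
  apply/weak_leP => p q pq h.
  have [pa|pa] := eqVneq p a.
    subst p; have [qc|qc] := eqVneq q c; first by subst q; lia.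
    have qa : q != a by rewrite -val_eqE /=; lia.
    by have := J2 q qa qc; rewrite /blkJ /R; have := wR q qa qc; lia.
  have [qa|qa] := eqVneq q a.
    subst q; have pc : p != c by rewrite -val_eqE /=; lia.
    have := J1 p pa pc; rewrite /blkJ /R; lia.
  have [qc|qc] := eqVneq q c.
    subst q; have pc : p != c by rewrite -val_eqE /=; lia.
    have := J1 p pa pc; rewrite /blkJ /R.
    have := wR _ pa pc; have := ne _ _ pa; lia.
  have [pc|pc] := eqVneq p c.
    by subst p; have := J2 q qa qc; rewrite /blkJ /R; lia.
  have := J3 q p qa qc pa pc.
  have := J1 p pa pc; have := J2 q qa qc; have := wR q qa qc; have := wR p pa pc.
  have := ne _ _ qa; have := ne _ _ qc; have := ne _ _ pa; have := ne _ _ pc.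
  have -> : (val q < val p) = false by apply/negbTE; rewrite -leqNgt ltnW.
  rewrite /blkJ /R; lia.
have MU : (pos M b < pos M a) = U b.+1.
  have := M1 b nba nbc; have := M2 b nba nbc; rewrite /blkM /R; lia.
have JU : (pos J b < pos J a) = U b.+1.
  have := J1 b nba nbc; have := J2 b nba nbc; rewrite /blkJ /R; lia.
have [nca nab' ncb] : [/\ c != a, a != b & c != b] by split; rewrite eq_sym.
have viaM := proj2 (perspective th_cong wM sw_ac sM).
have viaJ := proj1 (perspective th_cong Jw sJ sw_ac).
have [eab|nab] := eqVneq (b : nat) a.+1; last first.
  (* When [b] is not next to [a], the value [a'] following [a] becomes the middle letter of a
     hexagon. The cover exchanging [a'] and [c] still has the witness [b] and is contracted by
     induction. *)
  have an : a.+1 < n by have := ltn_ord b; lia.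
  pose a' := Ordinal an.
  have aa' : a < a' by [].
  have a'b : a' < b by rewrite /=; lia.
  have na'a : a' != a by rewrite -val_eqE gtn_eqF.
  have na'c : a' != c by rewrite -val_eqE ltn_eqF // (ltn_trans a'b).
  have na'b : a' != b by rewrite -val_eqE ltn_eqF.
  have [naa' nca'] : [/\ a != a' & c != a'] by split; rewrite eq_sym.
  have a'c : a' < c := ltn_trans a'b bc.
  have lek' : c - a' < k by clear -lek aa' a'c; lia.
  (* If [a'] precedes [a], it is the least letter of the descending front block of [M] and stands
     right before [a]; exchanging the two yields the bottom [u] of the hexagon. *)
  have [Ra'|Ra'] := boolP (R a').
    have bla' : blkM a' by rewrite /blkM Ra' orbT.
    have eMa : pos M a = (pos M a').+1.
      apply: pos_succ; first exact: M1.
      move=> v v1 v2.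
      have va : v != a by apply: contraTneq v2 => ->; rewrite ltnn.
      have vc : v != c by apply: contraTneq v2 => ->; rewrite eM -leqNgt leqnSn.
      have blv : blkM v by apply: contraTT v2 => /(M2 v va vc); rewrite eM -leqNgt => /ltnW/ltnW.
      have := M3 a' v na'a na'c va vc; rewrite bla' blv gME /= v1.
      move=> /(_ erefl) /= h; move: blv (ne _ _ va); rewrite /blkM /R => blv hne; clear -ac blv h hne; lia.
    apply: viaM; set u := (M * tperm a a')%g.
    have uM : (u * tperm a a')%g = M by rewrite /u -mulgA tperm2 mulg1.
    have ea' : pos u a' = (pos u a).+1 by rewrite !pos_swap tpermL tpermR.
    have ec : pos u c = (pos u a').+1 by rewrite !pos_swap tpermR tpermD.
    rewrite -uM; apply: (proj1 (hexagon_forcing th_cong aa' a'c ea' ec _)).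
    left; apply: (IH u a' b c lek' (conj ec a'c) a'b bc).
    by rewrite !pos_swap tpermR (tpermD nab' na'b).
  (* Otherwise [a'] is the least letter of the ascending rear block of [J] and stands right after
     [c]; the bottom [u] arises by exchanging these two. *)
  have bla' : ~~ blkJ a' by rewrite /blkJ (negbTE Ra') orbF -leqNgt.
  have eJa : pos J a' = (pos J c).+1.
    apply: pos_succ; first exact: J2.
    move=> v v1 v2.
    have va : v != a by apply: contraTneq v1 => ->; rewrite eJ -leqNgt leqnSn.
    have vc : v != c by apply: contraTneq v1 => ->; rewrite ltnn.
    have blv : ~~ blkJ v by apply: contraTN v1 => /(J1 v va vc); rewrite eJ -leqNgt => /ltnW/leqW.
    have := J3 v a' va vc na'a na'c; rewrite (negbTE bla') (negbTE blv) v2 /=.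
    move=> /(_ erefl) /= h; move: blv (ne _ _ va); rewrite /blkJ /R => blv hne; clear -ac blv h hne; lia.
  apply: viaJ; set u := (J * tperm a' c)%g.
  have uJ : (u * tperm a' c)%g = J by rewrite /u -mulgA tperm2 mulg1.
  have ea' : pos u a' = (pos u a).+1.
    by rewrite !pos_swap tpermL (@tpermD _ a' c a).
  have ec : pos u c = (pos u a').+1 by rewrite !pos_swap tpermL tpermR.
  rewrite -uJ; apply: (proj2 (hexagon_forcing th_cong aa' a'c ea' ec _)).
  left; apply: (IH u a' b c lek' (conj ec a'c) a'b bc).
  rewrite !pos_swap tpermL (tpermD na'b ncb) -JU.
  move: (pos_neq J nba) (pos_neq J nbc); clear -eJ; lia.
have [ebc|nbc'] := eqVneq (c : nat) b.+1; first exact: forcing_generator Ub.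
(* Here [b] is next to [a] but not to [c], and the mirrored argument uses [c'], the value preceding
   [c], as the middle letter. *)
have cn : c.-1 < n by have := ltn_ord c; lia.
pose c' := Ordinal cn.
have c'c : c' < c by rewrite /=; lia.
have bc' : b < c' by rewrite /=; lia.
have ac' : a < c' := ltn_trans ab bc'.
have nc'a : c' != a by rewrite -val_eqE /=; lia.
have nc'c : c' != c by rewrite -val_eqE /=; lia.
have nc'b : c' != b by rewrite -val_eqE /=; lia.
have [nac' ncc'] : [/\ a != c' & c != c'] by split; rewrite eq_sym.
have lek' : c' - a < k by clear -lek ac' c'c; lia.
have [Rc'|Rc'] := boolP (R c').
  have blc' : blkJ c' by rewrite /blkJ Rc' orbT.
  have eJa : pos J a = (pos J c').+1.
    apply: pos_succ; first exact: J1.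
    move=> v v1 v2.
    have va : v != a by apply: contraTneq v2 => ->; rewrite ltnn.
    have vc : v != c by apply: contraTneq v2 => ->; rewrite eJ -leqNgt leqnSn.
    have blv : blkJ v by apply: contraTT v2 => /(J2 v va vc); rewrite eJ -leqNgt => /ltnW/ltnW.
    have := J3 c' v nc'a nc'c va vc; rewrite blc' blv v1 /=.
    move=> /(_ erefl) /= h; move: blv (ne _ _ va); rewrite /blkJ /R => blv hne; clear -ac blv h hne; lia.
  apply: viaJ; set u := (J * tperm a c')%g.
  have uJ : (u * tperm a c')%g = J by rewrite /u -mulgA tperm2 mulg1.
  have ec' : pos u c' = (pos u a).+1 by rewrite !pos_swap tpermL tpermR.
  have ec : pos u c = (pos u c').+1.
    by rewrite !pos_swap tpermR (@tpermD _ a c' c).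
  rewrite -uJ; apply: (proj1 (hexagon_forcing th_cong ac' c'c ec' ec _)).
  right; apply: (IH u a b c' lek' (conj ec' ac') ab bc').
  rewrite !pos_swap tpermL (tpermD nab' nc'b) -JU.
  move: (pos_neq J nba) (pos_neq J nc'b); clear -eJa; lia.
have blc' : ~~ blkM c' by rewrite /blkM (negbTE Rc') orbF -leqNgt ltnW.
have eMc : pos M c' = (pos M c).+1.
  apply: pos_succ; first exact: M2.
  move=> v v1 v2.
  have va : v != a by apply: contraTneq v1 => ->; rewrite eM -leqNgt leqnSn.
  have vc : v != c by apply: contraTneq v1 => ->; rewrite ltnn.
  have blv : ~~ blkM v by apply: contraTN v1 => /(M1 v va vc); rewrite eM -leqNgt => /ltnW/leqW.
  have := M3 v c' va vc nc'a nc'c; rewrite (negbTE blc') (negbTE blv) gME v2 /=.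
  move=> /(_ erefl) /= h; move: blv (ne _ _ vc); rewrite /blkM /R => blv hne; clear -ac blv h hne; lia.
apply: viaM; set u := (M * tperm c' c)%g.
have uM : (u * tperm c' c)%g = M by rewrite /u -mulgA tperm2 mulg1.
have ec' : pos u c' = (pos u a).+1.
  by rewrite !pos_swap tpermL (@tpermD _ c' c a).
have ec : pos u c = (pos u c').+1 by rewrite !pos_swap tpermL tpermR.
rewrite -uM; apply: (proj2 (hexagon_forcing th_cong ac' c'c ec' ec _)).
right; apply: (IH u a b c' lek' (conj ec' ac') ab bc').
by rewrite !pos_swap (tpermD nc'b ncb) (tpermD nc'a nca).
Qed.
End ForcingAll.

(** * Cuts, lattice paths and triangulations *)

Section Cuts.
Variables (n : nat) (U : nat -> bool).
Notation vertex := 'I_n.+2.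
Notation pair := (vertex * vertex)%type.
Implicit Types (x y : 'S_n) (d e : pair) (p q m : 'I_n) (T : {set pair}).

(* A label k : 'I_n stands for the vertex k.+1 of the polygon. *)
Definition vtx p : vertex := lift ord0 (widen_ord (leqnSn n) p).

Lemma vtxE p : vtx p = p.+1 :> nat.
Proof. by []. Qed.

Lemma vtx_inj : injective vtx.
Proof. by move=> p q /(congr1 val) [/val_inj]. Qed.

Lemma vtxP (i : vertex) : 0 < i -> i < n.+1 -> exists p, i = vtx p.
Proof.
move=> i0 i1; have h : i.-1 < n by lia.
by exists (Ordinal h); apply: val_inj; rewrite [RHS]vtxE /=; lia.
Qed.

(* The labels that a lattice path having d as one of its steps has already, *)
(* resp. has not yet, read: cf path_step_cut.                               *)
Definition below_cut d p : bool :=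
  if U p.+1 then (p.+1 == d.1) || (p.+1 == d.2) else d.1 < p.+1 < d.2.
Definition above_cut d p : bool :=
  if U p.+1 then d.1 < p.+1 < d.2 else (p.+1 == d.1) || (p.+1 == d.2).

(** Crossing read off the labels. Interleaved segments cross when the two inner end points are on
    the same side of the axis, nested ones when the ends of the inner segment are on different
    sides. The strict inequalities exclude shared end points. *)
Definition crosses d e : bool :=
  [|| [&& d.1 < e.1, e.1 < d.2, d.2 < e.2 & U e.1 == U d.2],
      [&& e.1 < d.1, d.1 < e.2, e.2 < d.2 & U d.1 == U e.2],
      [&& d.1 < e.1, e.2 < d.2 & U e.1 != U e.2] |
      [&& e.1 < d.1, d.2 < e.2 & U d.1 != U d.2]].

Lemma crossesC d e : crosses d e = crosses e d.
Proof. by rewrite /crosses orbCA; congr [|| _, _ | _]; rewrite orbC. Qed.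

Lemma crosses_irr d : crosses d d = false.
Proof. by rewrite /crosses !ltnn. Qed.

(** The segment [d] asks for [p] before [q], and [e] asks for the opposite. Together with the
    converse [crosses_cut], crossing means precisely that two such demands conflict. *)
Lemma cut_crosses d e p q :
  below_cut d p -> above_cut e p -> above_cut d q -> below_cut e q ->
  crosses d e.
Proof.
rewrite /below_cut /above_cut /crosses.
case Up : (U p.+1); case Uq : (U q.+1);
  do 4 (first [case/orP=> /eqP ? | case/andP=> ? ?]);
  repeat match goal with E : _.+1 = nat_of_ord _ |- _ => rewrite -?E; revert E end;
  rewrite ?Up ?Uq; try lia.
all: by move=> _ e'; move: Up; rewrite -e' Uq.
Qed.

Lemma crosses_cut d e : d.1 < d.2 -> e.1 < e.2 -> crosses d e ->
  exists p q, [/\ below_cut d p, above_cut e p, above_cut d q & below_cut e q].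
Proof.
move=> dd ee.
wlog : d e dd ee / (d.1 < e.1).
  move=> wl c; have [lt|gt|eq] := ltngtP d.1 e.1.
  - exact: wl.
  - have [|p [q [h1 h2 h3 h4]]] := wl e d ee dd gt; first by rewrite crossesC.
    by exists q, p.
  - by move: c; rewrite /crosses eq !ltnn.
move=> de; rewrite /crosses; have -> : (e.1 < d.1) = false by lia.
rewrite de /=.
have [p ep] : exists p, e.1 = vtx p by apply: vtxP; have := ltn_ord e.2; lia.
rewrite orbF => /orP[/and3P[ed de2 /eqP Ueq]|/andP[ed2 Une]].
  have [q eq] : exists q, d.2 = vtx q by apply: vtxP; have := ltn_ord e.2; lia.
  move: de ed de2 Ueq; rewrite /below_cut /above_cut ep eq !vtxE.
  move=> ? ? ? Ueq; case Up : (U p.+1) (Ueq) => /esym Uq.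
    by exists q, p; rewrite Up Uq; split; lia.
  by exists p, q; rewrite Up Uq; split; lia.
have [q eq] : exists q, e.2 = vtx q by apply: vtxP; have := ltn_ord d.2; lia.
move: de ed2 ee Une; rewrite /below_cut /above_cut ep eq !vtxE => ? ? ?.
case Up : (U p.+1); case Uq : (U q.+1) => // _.
  by exists q, p; rewrite Up Uq; split; lia.
by exists p, q; rewrite Up Uq; split; lia.
Qed.

(** A polygon edge is on the upper boundary when no label is above it and on the lower boundary when
    none is below it. The vertices [0] and [n.+1] carry no label and belong to both boundaries. *)
Lemma adjacentE d : d.1 < d.2 -> adjacent n U d.1 d.2 =
  [forall p, ~~ above_cut d p] || [forall p, ~~ below_cut d p].
Proof.
move=> dd; rewrite /adjacent dd /=; congr (_ || _).
  apply/idP/forallP => [/andP[/andP[u1 u2] /forallP h] p|h].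
    have := h (vtx p); rewrite /above_cut /on_up !vtxE /= in u1 u2 *.
    case Up : (U p.+1); first by rewrite orbT andbT.
    move=> _; apply/negP => /orP[]/eqP e; [move: u1|move: u2]; rewrite -e Up;
      have := ltn_ord p; lia.
  apply/andP; split.
    have H (i : vertex) : (i == d.1) || (i == d.2) -> on_up n U i.
      move=> id; rewrite /on_up; have [//|i0] := eqVneq (i : nat) 0.
      have [//|i1] := eqVneq (i : nat) n.+1.
      have [p ip] : exists p, i = vtx p by apply: vtxP; have := ltn_ord i; lia.
      have := h p; rewrite /above_cut ip vtxE /=; case: (U _) => //.
      by move: id; rewrite ip -!val_eqE /= => ->.
    by rewrite !H ?eqxx ?orbT.
  apply/forallP => k; apply/negP => /and3P[k1 k2].
  have [p kp] : exists p, k = vtx p by apply: vtxP; have := ltn_ord d.2; lia.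
  have := h p; rewrite /above_cut /on_up kp vtxE /= in k1 k2 *.
  have := ltn_ord p; case: (U _); rewrite ?k1 ?k2 //=; lia.
apply/idP/forallP => [/andP[/andP[u1 u2] /forallP h] p|h].
  have := h (vtx p); rewrite /below_cut /on_down !vtxE /= in u1 u2 *.
  case Up : (U p.+1); last by rewrite orbT andbT.
  move=> _; apply/negP => /orP[]/eqP e; [move: u1|move: u2]; rewrite -e Up;
    have := ltn_ord p; lia.
apply/andP; split.
  have H (i : vertex) : (i == d.1) || (i == d.2) -> on_down n U i.
    move=> id; rewrite /on_down; have [//|i0] := eqVneq (i : nat) 0.
    have [//|i1] := eqVneq (i : nat) n.+1.
    have [p ip] : exists p, i = vtx p by apply: vtxP; have := ltn_ord i; lia.
    have := h p; rewrite /below_cut ip vtxE /=; case: (U _) => //.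
    by move: id; rewrite ip -!val_eqE /= => ->.
  by rewrite !H ?eqxx ?orbT.
apply/forallP => k; apply/negP => /and3P[k1 k2].
have [p kp] : exists p, k = vtx p by apply: vtxP; have := ltn_ord d.2; lia.
have := h p; rewrite /below_cut /on_down kp vtxE /= in k1 k2 *.
have := ltn_ord p; case: (U _); rewrite ?k1 ?k2 //=; lia.
Qed.

Lemma is_diagP d : reflect
  [/\ d.1 < d.2, exists p, below_cut d p & exists q, above_cut d q]
  (is_diag n U d).
Proof.
rewrite /is_diag; case: (ltnP d.1 d.2) => dd /=; last by constructor; case.
rewrite adjacentE // negb_or; apply: (iffP andP) => [[]|[_ [p bp] [q aq]]].
  by rewrite !negb_forall => /existsP[q /negbNE aq] /existsP[p /negbNE bp];
    split; [|exists p|exists q].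
by rewrite !negb_forall; split; apply/existsP; [exists q|exists p]; rewrite negbK.
Qed.

Lemma cut_span d p : below_cut d p || above_cut d p -> d.1 < d.2 ->
  d.1 <= p.+1 <= d.2.
Proof. rewrite /below_cut /above_cut; case: (U _); lia. Qed.

Lemma below_above d p : below_cut d p -> above_cut d p -> False.
Proof. rewrite /below_cut /above_cut; case: (U _); lia. Qed.

Lemma span_cut d p : d.1 <= p.+1 <= d.2 -> below_cut d p || above_cut d p.
Proof. rewrite /below_cut /above_cut; case: (U _); lia. Qed.

(** Polygon edges satisfy this vacuously, having no label on one side; [triang_of] keeps only the
    diagonals. *)
Definition edge x d : bool :=
  (d.1 < d.2) && [forall p, forall q,
    below_cut d p ==> (above_cut d q ==> (pos x p < pos x q))].

Lemma edgeP x d : reflect (d.1 < d.2 /\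
    forall p q, below_cut d p -> above_cut d q -> pos x p < pos x q) (edge x d).
Proof.
apply: (iffP andP) => -[dd h]; split=> //.
  move=> p q bp aq; move/forallP: h => /(_ p)/forallP/(_ q).
  by rewrite bp aq.
by apply/forallP => p; apply/forallP => q; apply/implyP => bp; apply/implyP; apply: h.
Qed.

Definition triang_of x : {set pair} := [set d | is_diag n U d && edge x d].

Lemma edge_lt x d : edge x d -> d.1 < d.2.
Proof. by case/edgeP. Qed.

Lemma edge_noncrossing x d e : edge x d -> edge x e -> ~~ crosses d e.
Proof.
move=> /edgeP[dd hd] /edgeP[ee he]; apply/negP => /(crosses_cut dd ee).
by move=> [p [q [h1 h2 h3 h4]]]; have := hd _ _ h1 h3; have := he _ _ h4 h2; lia.
Qed.

(* The lattice path after t letters has acquired the upper vertices among *)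
(* them and lost the lower ones.                                          *)
Definition on_path x (t : nat) (i : vertex) : bool :=
  [|| i == 0 :> nat, i == n.+1 :> nat | [exists p, (i == vtx p) &&
     (if U p.+1 then pos x p < t else t <= pos x p)]].

Lemma on_path_vtx x t p :
  on_path x t (vtx p) = if U p.+1 then pos x p < t else t <= pos x p.
Proof.
rewrite /on_path vtxE /=.
have -> : (p.+1 == n.+1) = false by have := ltn_ord p; lia.
apply/existsP/idP => [[q /andP[/eqP/vtx_inj->]]//|h].
by exists p; rewrite eqxx.
Qed.

Lemma on_path0 x t (i : vertex) : i = 0 :> nat -> on_path x t i.
Proof. by rewrite /on_path => ->. Qed.

Lemma on_pathn x t (i : vertex) : i = n.+1 :> nat -> on_path x t i.
Proof. by rewrite /on_path => ->; rewrite eqxx orbT. Qed.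

Definition path_step x t d := [/\ d.1 < d.2, on_path x t d.1, on_path x t d.2 &
  forall k : vertex, d.1 < k -> k < d.2 -> ~~ on_path x t k].

Lemma path_step_cut x t d p : path_step x t d -> d.1 <= p.+1 <= d.2 ->
  (below_cut d p = (pos x p < t)) * (above_cut d p = (t <= pos x p)).
Proof.
case=> dd p1 p2 np /andP[]; rewrite /below_cut /above_cut.
have K (i : vertex) : p.+1 = i -> on_path x t i ->
    if U p.+1 then pos x p < t else t <= pos x p.
  move=> e; have -> : i = vtx p by apply: val_inj; rewrite [RHS]vtxE.
  by rewrite on_path_vtx.
rewrite leq_eqVlt => /orP[/eqP e1 _|d1p].
  by have := K _ (esym e1) p1; rewrite -e1; case: (U _) => h; split; lia.
rewrite leq_eqVlt => /orP[/eqP e2|d2p].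
  by have := K _ e2 p2; rewrite e2; case: (U _) => h; split; lia.
have := np (vtx p) d1p d2p; rewrite on_path_vtx d1p.
by have -> : p.+1 < d.2 by []; case: (U _) => h; split; lia.
Qed.

Lemma path_step_edge x t d : path_step x t d -> edge x d.
Proof.
move=> st; have dd : d.1 < d.2 by case: st.
apply/edgeP; split=> // p q bp aq.
have sp : d.1 <= p.+1 <= d.2 by apply: cut_span; rewrite ?bp.
have sq : d.1 <= q.+1 <= d.2 by apply: cut_span; rewrite ?aq ?orbT.
move: bp aq; rewrite (path_step_cut st sp) (path_step_cut st sq); lia.
Qed.

(** The step over the gap runs from the last path vertex up to [i] to the first one from [j] on;
    both exist because the vertices [0] and [n.+1] are on every path. *)
Lemma path_span x t (i j : vertex) : i < j ->
  (forall k : vertex, i < k -> k < j -> ~~ on_path x t k) ->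
  exists d, [/\ path_step x t d, d.1 <= i & j <= d.2].
Proof.
move=> ij no.
pose P (k : vertex) := on_path x t k && (k <= i).
pose Q (k : vertex) := on_path x t k && (j <= k).
have P0 : P ord0 by rewrite /P on_path0.
have Qn : Q ord_max by rewrite /Q on_pathn //= -ltnS ltn_ord.
case: (@arg_maxnP _ ord0 P (@nat_of_ord _) P0) => u /andP[pu ui] umax.
case: (@arg_minnP _ ord_max Q (@nat_of_ord _) Qn) => w /andP[pw wj] wmin.
exists (u, w); split=> //; split=> //=; first by lia.
move=> k uk kw; apply/negP => pk.
have k1 : i < k.
  by rewrite ltnNge; apply/negP => ki; have := umax k; rewrite /P pk ki => /(_ isT) /=; lia.
have k2 : k < j.
  by rewrite ltnNge; apply/negP => ki; have := wmin k; rewrite /Q pk ki => /(_ isT) /=; lia.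
by have := no k k1 k2; rewrite pk.
Qed.

Definition between (p m q : nat) := (p < m < q) || (q < m < p).

Definition dep T p q := [exists d, [&& d \in T, below_cut d p & above_cut d q]].

Lemma depP T p q :
  reflect (exists d, [/\ d \in T, below_cut d p & above_cut d q]) (dep T p q).
Proof.
by apply: (iffP existsP) => -[d h]; exists d; [case/and3P: h|apply/and3P].
Qed.

Lemma path_span_labels x t p q : p != q ->
  (forall m, between p m q -> ~~ on_path x t (vtx m)) ->
  exists d, [/\ path_step x t d, d.1 <= p.+1 <= d.2 & d.1 <= q.+1 <= d.2].
Proof.
wlog lt : p q / p < q.
  move=> wl pq h; have [lt|gt|/val_inj eq] := ltngtP p q.
  - exact: wl.
  - have [||d [st h1 h2]] := wl q p gt; first by rewrite eq_sym.
      by move=> m bm; apply: h; rewrite /between orbC.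
    by exists d.
  - by rewrite eq eqxx in pq.
move=> _ h; have [d [st h1 h2]] : exists d, [/\ path_step x t d, d.1 <= p.+1 & q.+1 <= d.2].
  rewrite -!vtxE; apply: path_span => // k pk kq.
  have [m km] : exists m, k = vtx m.
    by apply: vtxP; [|have := ltn_ord q]; move: pk kq; rewrite !vtxE; lia.
  rewrite km; apply: h; rewrite /between; move: pk kq; rewrite km !vtxE; lia.
by exists d; split=> //; lia.
Qed.

(** One step of the path at time [t] spans both labels and separates letters already read from
    unread ones. With [p] below and [q] above, it is a diagonal. *)
Lemma dep_path x t p q : pos x p < t -> t <= pos x q ->
  (forall m, between p m q -> ~~ on_path x t (vtx m)) -> dep (triang_of x) p q.
Proof.
move=> pt tq h.
have pq : p != q by apply: contraTneq tq => <-; rewrite -ltnNge.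
have [d [st sp sq]] := path_span_labels pq h.
have bp : below_cut d p by rewrite (path_step_cut st sp).
have aq : above_cut d q by rewrite (path_step_cut st sq).
apply/depP; exists d; split=> //; rewrite inE (path_step_edge st) andbT.
by apply/is_diagP; split; [case: st|exists p|exists q].
Qed.

Lemma dep_triang_of x p q : dep (triang_of x) p q -> pos x p < pos x q.
Proof.
by case/depP => d [+ bp aq]; rewrite inE => /andP[_ /edgeP[_ h]]; apply: h.
Qed.

(** If [d] is not compatible with [x], some [q] above [d] is read before some [p] below it. The path
    just before [p] is read then has vertices on both sides of [d], and one of its steps crosses
    [d]. *)
Lemma triang_of_maximal x d : is_diag n U d -> ~~ edge x d ->
  exists2 e, e \in triang_of x & crosses d e.
Proof.
move=> dg ne; have [dd _ _] := is_diagP _ dg.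
have [p [q [bp aq le]]] :
    exists p q, [/\ below_cut d p, above_cut d q & pos x q <= pos x p].
  move: ne; rewrite /edge dd /= negb_forall => /existsP[p].
  rewrite negb_forall => /existsP[q]; rewrite !negb_imply -leqNgt => /and3P[].
  by exists p, q.
have lt : pos x q < pos x p.
  rewrite ltn_neqAle le andbT; apply: pos_neq.
  by apply/eqP => e; rewrite e in aq; apply: (below_above bp aq).
set t := pos x p in lt.
(* Path vertices beyond an end of [d] count as low when that end is an upper vertex not yet
   acquired, since the path runs under it, and as high when it is a lower vertex already deleted. *)
pose low (i : vertex) := on_path x t i &&
  [|| [&& i < d.1, U d.1 & ~~ on_path x t d.1], (d.1 < i < d.2) && ~~ U i |
      [&& d.2 < i, U d.2 & ~~ on_path x t d.2]].
pose high (i : vertex) := on_path x t i &&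
  [|| [&& i < d.1, ~~ U d.1 & ~~ on_path x t d.1], (d.1 < i < d.2) && U i |
      [&& d.2 < i, ~~ U d.2 & ~~ on_path x t d.2]].
have vE (i : vertex) (r : 'I_n) : r.+1 = i :> nat -> i = vtx r.
  by move=> e; apply: val_inj; rewrite [RHS]vtxE.
have [i li] : exists i, low i.
  move: bp; rewrite /below_cut; case Up : (U _); last first.
    by move=> h; exists (vtx p); rewrite /low on_path_vtx vtxE Up h leqnn orbT.
  case/orP=> /eqP e.
    exists ord0; rewrite /low on_path0 //= -e Up (vE _ _ e) on_path_vtx Up.
    by rewrite ltnn.
  exists ord_max; rewrite /low on_pathn //= -e Up (vE _ _ e) on_path_vtx Up.
  by rewrite ltnn /=; have := ltn_ord p; lia.
have [j hj] : exists j, high j.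
  move: aq; rewrite /above_cut; case Uq : (U _).
    by move=> h; exists (vtx q); rewrite /high on_path_vtx vtxE Uq h lt orbT.
  case/orP=> /eqP e.
    exists ord0; rewrite /high on_path0 //= -e Uq (vE _ _ e) on_path_vtx Uq.
    by rewrite -ltnNge lt.
  exists ord_max; rewrite /high on_pathn //= -e Uq (vE _ _ e) on_path_vtx Uq.
  by rewrite -ltnNge lt /=; have := ltn_ord q; lia.
have lowhigh (k : vertex) : low k -> high k -> False.
  by move: dd; rewrite /low /high; clear; case: (U k); case: (U d.1); case: (U d.2); lia.
(* By [mid], every path vertex between a low and a high one is itself low or high; shrinking the
   interval ends at a single step that changes sides. *)
have [e [st ev]] : exists e, path_step x t e /\
    (low e.1 && high e.2 || high e.1 && low e.2).
  have mid (i' j' k : vertex) : low i' -> high j' -> on_path x t k ->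
      between i' k j' -> low k || high k.
    rewrite /low /high /between => h1 h2 pk; rewrite pk /=.
    have [e|k1] := eqVneq k d.1; first by move: h1 h2 dd; rewrite -e pk; clear; lia.
    have [e|k2] := eqVneq k d.2; first by move: h1 h2 dd; rewrite -e pk; clear; lia.
    move: k1 k2 h1 h2 dd; rewrite -!val_eqE /=; clear.
    by case: (U k); case: (U d.1); case: (U d.2); lia.
  have [s] := ubnP ((i - j) + (j - i)); elim: s i j li hj => // s IH i j li hj les.
  have [k /andP[pk bk]|no] := pickP (fun k : vertex => on_path x t k && between i k j).
    move: (bk) les; rewrite /between => bk' les.
    by case/orP: (mid i j k li hj pk bk) => hk; [apply: (IH k j)|apply: (IH i k)] => //;
      clear -bk' les; lia.
  have [ij|ji|/val_inj ij] := ltngtP i j.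
  - exists (i, j); split=> /=; last by rewrite li hj.
    split=> //=; [by case/andP: li|by case/andP: hj|move=> k k1 k2].
    by apply/negP => pk; have := no k; rewrite pk /between k1 k2.
  - exists (j, i); split=> /=; last by rewrite li hj orbT.
    split=> //=; [by case/andP: hj|by case/andP: li|move=> k k1 k2].
    by apply/negP => pk; have := no k; rewrite pk /between k1 k2 orbT.
  - by subst j; case: (lowhigh i li hj).
have [ee _ _ _] := st.
have cr : crosses d e.
  move: ev dd ee; rewrite /low /high /crosses; clear.
  by case: (U e.1); case: (U e.2); case: (U d.1); case: (U d.2) => /=; lia.
exists e => //; rewrite inE (path_step_edge st) andbT.
have [p' [q' [h1 h2 h3 h4]]] := crosses_cut dd ee cr.
by apply/is_diagP; split=> //; [exists q'|exists p'].
Qed.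

Definition ctriang T :=
  [/\ (forall d, d \in T -> is_diag n U d),
      (forall d e, d \in T -> e \in T -> ~~ crosses d e) &
      (forall d, is_diag n U d -> d \notin T -> exists2 e, e \in T & crosses d e)].

Lemma triang_ofP x : ctriang (triang_of x).
Proof.
split=> [d|d e|d dg].
- by rewrite inE => /andP[].
- by rewrite !inE => /andP[_ hd] /andP[_ he]; apply: edge_noncrossing hd he.
- by rewrite inE dg /= => /(triang_of_maximal dg).
Qed.

Lemma ctriang_sub T T' : ctriang T -> ctriang T' -> T \subset T' -> T = T'.
Proof.
move=> [_ _ hT] [dg nc _] sub; apply/eqP; rewrite eqEsubset sub /=.
apply/subsetP => d dT'; apply: contraT => /(hT _ (dg _ dT'))[e eT].
by rewrite (negbTE (nc _ _ dT' (subsetP sub _ eT))).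
Qed.

(** All diagonals of [T] are then compatible with [x], and a maximal noncrossing family contained in
    another one equals it. So every linear extension of [dep T] is in the fibre of [T]. *)
Lemma triang_of_dep T x : ctriang T ->
  (forall p q, dep T p q -> pos x p < pos x q) -> triang_of x = T.
Proof.
move=> cT h; apply/esym; apply: ctriang_sub => //; first exact: triang_ofP.
have [dg _ _] := cT.
apply/subsetP => d dT; rewrite inE dg //=; apply/edgeP; split.
  by case/is_diagP: (dg _ dT).
by move=> p q bp aq; apply: h; apply/depP; exists d.
Qed.
End Cuts.

(** * The dependency order of a triangulation *)

Section DepOrder.
Variables (n : nat) (U : nat -> bool).
Notation vertex := 'I_n.+2.
Notation pair := (vertex * vertex)%type.
Implicit Types (x y : 'S_n) (d e : pair) (p q m a c : 'I_n) (T : {set pair}).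
Local Notation dep := (dep U).
Local Notation below_cut := (below_cut U).
Local Notation above_cut := (above_cut U).

Section OneTriangulation.
Variable T : {set pair}.
Hypothesis T_tri : ctriang U T.

Lemma dep_irr p : dep T p p = false.
Proof.
by apply/negbTE/negP => /depP[d [_ bp ap]]; apply: (below_above bp ap).
Qed.

(** The label [m] is in the span of the same diagonal, hence below or above it. *)
Lemma dep_between p m q : dep T p q -> between p m q -> dep T p m \/ dep T m q.
Proof.
case/depP => d [dT bp aq] bm.
have dd : d.1 < d.2 by case: T_tri => dg _ _; case/is_diagP: (dg _ dT).
have sp : d.1 <= p.+1 <= d.2 by apply: (cut_span (U := U)); rewrite ?bp.
have sq : d.1 <= q.+1 <= d.2 by apply: (cut_span (U := U)); rewrite ?aq ?orbT.
have sm : d.1 <= m.+1 <= d.2 by move: bm; rewrite /between; lia.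
by case/orP: (span_cut U sm) => h; [right|left]; apply/depP; exists d.
Qed.

(** Since [q] is not between [p] and [r], one of these two lies in the spans of both diagonals. On
    the side that does not give the dependency, it would make the two diagonals cross. *)
Lemma dep_turn p q r : dep T p q -> dep T q r -> ~~ between p q r -> dep T p r.
Proof.
move=> pq qr nb.
have npq : p != q by apply: contraTneq pq => ->; rewrite dep_irr.
have nqr : q != r by apply: contraTneq qr => ->; rewrite dep_irr.
case/depP: pq => d [dT bp aq]; case/depP: qr => e [eT bq ar].
have [dg nc _] := T_tri.
have [dd _ _] := is_diagP _ _ (dg _ dT); have [ee _ _] := is_diagP _ _ (dg _ eT).
have sp : d.1 <= p.+1 <= d.2 by apply: (cut_span (U := U)); rewrite ?bp.
have sq : d.1 <= q.+1 <= d.2 by apply: (cut_span (U := U)); rewrite ?aq ?orbT.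
have sq' : e.1 <= q.+1 <= e.2 by apply: (cut_span (U := U)); rewrite ?bq.
have sr : e.1 <= r.+1 <= e.2 by apply: (cut_span (U := U)); rewrite ?ar ?orbT.
have nc' := nc d e dT eT.
have [pe|rd] : e.1 <= p.+1 <= e.2 \/ d.1 <= r.+1 <= d.2.
  move: npq nqr nb; rewrite /between -!val_eqE /=; clear -sp sq sq' sr; lia.
- case/orP: (span_cut U pe) => h; first by apply/depP; exists e.
  by rewrite (cut_crosses bp h aq bq) in nc'.
- case/orP: (span_cut U rd) => h; last by apply/depP; exists d.
  by rewrite (cut_crosses h ar aq bq) in nc'.
Qed.

Local Notation le := (connect (dep T)).

(** * Chains of dependencies, for the values numbered upwards or downwards *)

Section Ranked.
Variable r : 'I_n -> nat.
Hypothesis r_inj : injective r.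
Hypothesis r_between : forall p m q,
  between p m q = (r p < r m < r q) || (r q < r m < r p).

Definition up_dep p q := dep T p q && (r p < r q).
Definition down_dep p q := dep T p q && (r q < r p).

(* Turning points of a dependency chain can be short-cut, so a chain of *)
(* minimal length is monotone.                                           *)
Lemma monotone_chain p s : path (dep T) p s -> s != [::] ->
  exists s', [/\ s' != [::], last p s' = last p s, size s' <= size s &
    path up_dep p s' || path down_dep p s'].
Proof.
have [k] := ubnP (size s); elim: k p s => // k IH p [//|p1 s] /= les /andP[d1 ps] _.
have rne : r p != r p1.
  by rewrite (inj_eq r_inj); apply: contraTneq d1 => ->; rewrite dep_irr.
have one : up_dep p p1 || down_dep p p1.
  by rewrite /up_dep /down_dep d1 /= -neq_ltn.
have [s0|s_ne] := eqVneq s [::].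
  by exists [:: p1]; rewrite s0 /= !andbT.
have [s2 [n2 l1 z1 m1]] := IH p1 s les ps s_ne.
case: s2 n2 l1 z1 m1 => // p2 s1 _ l1 z1 m1.
have [turn|noturn] := boolP ((up_dep p p1 && down_dep p1 p2) ||
                             (down_dep p p1 && up_dep p1 p2)).
  have d2 : dep T p1 p2 by case/orP: turn => /andP[_ /andP[]].
  have d3 : dep T p p2.
    apply: dep_turn d1 d2 _; rewrite r_between.
    by move: turn; rewrite /up_dep /down_dep; case: (dep T _ _) => //;
       case: (dep T _ _) => //=; clear; lia.
  have ps1 : path (dep T) p (p2 :: s1).
    rewrite /= d3; case/orP: m1 => /= /andP[_];
      by apply: sub_path => u v /andP[].
  have les1 : size (p2 :: s1) < k by exact: (leq_ltn_trans z1 les).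
  have [s' [n' l' z' m']] := IH p (p2 :: s1) les1 ps1 isT.
  by exists s'; split=> //; [rewrite l'|apply: leq_trans z' (leqW z1)].
exists (p1 :: p2 :: s1); split=> //=.
case/orP: one => h1; rewrite h1 /= in noturn *.
  case/orP: m1 => /= /andP[h2 h3]; first by rewrite h2 h3.
  by rewrite h2 in noturn.
case/orP: m1 => /= /andP[h2 h3]; last by rewrite h2 h3 orbT.
by rewrite h2 orbT in noturn.
Qed.

Lemma up_path_lt p s : path up_dep p s -> s != [::] -> r p < r (last p s).
Proof.
elim: s p => //= p1 s IH p /andP[/andP[_ lt] ps] _.
have [->//|ne] := eqVneq s [::].
exact: ltn_trans lt (IH _ ps ne).
Qed.

Lemma down_path_lt p s : path down_dep p s -> s != [::] -> r (last p s) < r p.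
Proof.
elim: s p => //= p1 s IH p /andP[/andP[_ lt] ps] _.
have [->//|ne] := eqVneq s [::].
exact: ltn_trans (IH _ ps ne) lt.
Qed.

Lemma le_down p q : le p q -> r q < r p -> connect down_dep p q.
Proof.
case/connectP => s ps eq lt.
have ne : s != [::] by apply: contraTneq lt => s0; rewrite eq s0 ltnn.
have [s' [n' l' _ /orP[m|m]]] := monotone_chain ps ne.
  by have := up_path_lt m n'; rewrite l' -eq; lia.
by apply/connectP; exists s'; rewrite ?l'.
Qed.

(** A cycle would shorten to a nonempty monotone chain returning to its start. *)
Lemma ranked_le_anti p q : le p q -> le q p -> p = q.
Proof.
case/connectP => s ps eq /connectP[s1 ps1 eq1].
have [//|ne] := eqVneq p q.
have sn : s ++ s1 != [::] by case: s eq ne {ps} => //= ->; rewrite eqxx.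
have ps2 : path (dep T) p (s ++ s1) by rewrite cat_path ps -eq.
have [s' [n' l' _ m]] := monotone_chain ps2 sn.
have e : last p s' = p by rewrite l' last_cat -eq -eq1.
by case/orP: m => m; [have := up_path_lt m n'|have := down_path_lt m n'];
  rewrite e ltnn.
Qed.
End Ranked.

Lemma val_between p m q : between p m q = (p < m < q) || (q < m < p).
Proof. by []. Qed.

Lemma le_anti p q : le p q -> le q p -> p = q.
Proof. exact: (ranked_le_anti val_inj val_between). Qed.

(** Some link of the chain ends at [m] or passes over it, and there [dep_between] applies. *)
Lemma le_between p m q : le p q -> between p m q -> le p m \/ le m q.
Proof.
case/connectP => s; elim: s p => [|p1 s IH] p /=.
  by move=> _ ->; rewrite /between; lia.
case/andP => d1 ps eq bm.
have [e|ne] := eqVneq m p1.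
  by left; rewrite e; apply: connect1.
have [b1|nb1] := boolP (between p m p1).
  case: (dep_between d1 b1) => h; [left|right]; first exact: connect1.
  by apply: connect_trans (connect1 h) _; apply/connectP; exists s.
have b2 : between p1 m q.
  by move: bm nb1 ne; rewrite /between -val_eqE /=; clear; lia.
by case: (IH p1 ps eq b2) => h; [left|right] => //; apply: connect_trans (connect1 d1) h.
Qed.

(* With r increasing this is the smallest linear extension of le in the weak *)
(* order, and with r decreasing the largest one.                             *)
Lemma extremal_perm (r : 'I_n -> nat) : injective r ->
  (forall p m q, between p m q = (r p < r m < r q) || (r q < r m < r p)) ->
  exists x : 'S_n, (forall p q, dep T p q -> pos x p < pos x q) /\
    forall p q, r p < r q -> (pos x q < pos x p) = le q p.
Proof.
move=> r_inj r_btw.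
(* Sort by [r] except where [le] demands the reverse order. Transitivity is a case check from
   antisymmetry, transitivity and the betweenness property of [le]. *)
pose L p q := (r p < r q) && ~~ le q p || (r q < r p) && le p q.
have [x xL] : exists x : 'S_n, forall p q, (pos x p < pos x q) = L p q.
  apply: perm_of_order => [p|q p s|p q]; rewrite /L.
  - by rewrite ltnn.
  - have A u v : u != v -> ~~ (le u v && le v u).
      by apply: contra => /andP[h1 h2]; rewrite (le_anti h1 h2).
    have B u v w : le u v -> (r u < r w < r v) || (r v < r w < r u) -> le u w || le w v.
      by rewrite -r_btw => h1 h2; apply/orP; apply: (le_between h1 h2).
    have C u v w : le u v -> le v w -> le u w by apply: connect_trans.
    have N u v : u != v -> r u != r v by rewrite (inj_eq r_inj).
    have [e|/N/negbTE ns] := eqVneq p s.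
      by subst s; rewrite ltnn; case: (le p q); case: (le q p); case: ltngtP.
    move: (A p q) (A q s) (A p s) (B p q s) (B p s q) (B q p s) (B q s p)
      (B s p q) (B s q p) (C p q s) (C p s q) (C q p s) (C q s p)
      (C s p q) (C s q p).
    have [e|npq] := eqVneq p q; first by subst q; rewrite ltnn.
    have [e|nqs] := eqVneq q s; first by subst q; rewrite ltnn.
    have nps : p != s by apply/negP => /eqP e; move: ns; rewrite e eqxx.
    rewrite nps => /(_ isT) + /(_ isT) + /(_ isT).
    have := N _ _ npq; have := N _ _ nqs; move: (r p) (r q) (r s) ns => a b c; clear.
    case: (le p q); case: (le q p); case: (le p s); case: (le s p); case: (le q s);
    case: (le s q) => //=; lia.
  - by rewrite -(inj_eq r_inj) neq_ltn; case: (ltngtP (r p) (r q)) => //= _ _;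
      case: (le _ _).
exists x; split=> [p q d|p q lt]; last by rewrite xL /L lt ltnNge (ltnW lt).
have pq : p != q by apply: contraTneq d => ->; rewrite dep_irr.
rewrite xL /L; case: ltngtP => [lt|lt|/r_inj e]; last by rewrite e eqxx in pq.
  by rewrite /= orbF; apply/negP => h; have := le_anti h (connect1 d) => e; rewrite e eqxx in pq.
exact: connect1.
Qed.
End OneTriangulation.

(** * The dependency order along the weak order *)

Section Monotone.
Variables (x y : 'S_n) (r : 'I_n -> nat).
Hypothesis r_inj : injective r.
Hypothesis r_between : forall p m q,
  between p m q = (r p < r m < r q) || (r q < r m < r p).
Hypothesis xy : forall p q, r p < r q -> pos x q < pos x p -> pos y q < pos y p.
Local Notation lex := (connect (dep (triang_of U x))).
Local Notation ley := (connect (dep (triang_of U y))).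

(** Let [d] be a diagonal of [x] with [c] below and [a] above it. Either [y] still reads all its low
    labels in this range before the high ones, and a single dependency results, or a reversed pair
    splits the claim into two shorter instances joined by a dependency of [y]. *)
Lemma dep_monotone c a : r a < r c -> dep (triang_of U x) c a -> ley c a.
Proof.
have [k] := ubnP (r c - r a); elim: k c a => // k IH c a lek ac.
case/depP => d [dT bc aa].
have [ddg /edgeP[dd dx]] : is_diag n U d /\ edge U x d.
  by move: dT; rewrite inE => /andP.
have sc : d.1 <= c.+1 <= d.2 by apply: (cut_span (U := U)); rewrite ?bc.
have sa : d.1 <= a.+1 <= d.2 by apply: (cut_span (U := U)); rewrite ?aa ?orbT.
have sm m : between c m a -> below_cut d m = ~~ U m.+1.
  rewrite /between /below_cut => bm.
  by case: (U _) => //; clear -bm sc sa; lia.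
have sm' m : between c m a -> above_cut d m = U m.+1.
  rewrite /between /above_cut => bm.
  by case: (U _) => //; clear -bm sc sa; lia.
pose lows (e : 'I_n) := below_cut d e && ((e == c) || between c e a).
pose highs (u : 'I_n) := above_cut d u && ((u == a) || between c u a).
have rlow (e : 'I_n) : lows e -> r a < r e <= r c.
  by case/andP => _ /orP[/eqP->|]; rewrite ?ac ?leqnn // r_between; clear -ac; lia.
have rhigh u : highs u -> r a <= r u < r c.
  by case/andP => _ /orP[/eqP->|]; rewrite ?ac ?leqnn // r_between; clear -ac; lia.
have lc : lows c by rewrite /lows bc eqxx.
have ha : highs a by rewrite /highs aa eqxx.
have lh (e u : 'I_n) : lows e -> highs u -> e != u.
  case/andP => b1 _ /andP[a1 _]; apply/eqP => e1.
  by rewrite e1 in b1; apply: (below_above b1 a1).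
pose bad (eu : 'I_n * 'I_n) :=
  [&& lows eu.1, highs eu.2 & pos y eu.2 < pos y eu.1].
(* Without a bad pair, take the moment when [y] is about to read its first high label [u]: all low
   labels have been read and no path vertex remains between [c] and [a]. *)
have [eu0 bad0|good] := pickP bad; last first.
  case: (@arg_minnP _ a highs (pos y) ha) => u hu umin.
  have lt (e : 'I_n) : lows e -> pos y e < pos y u.
    move=> le; have := good (e, u); rewrite /bad /= le hu /= => /negbT.
    by have := pos_neq y (lh _ _ le hu); clear; lia.
  apply/connect1/(dep_path (t := pos y u)); [exact: lt|exact: umin|move=> m bm].
  rewrite on_path_vtx; case Um : (U m.+1).
    by rewrite -leqNgt; apply: umin; rewrite /highs sm' // Um bm orbT.
  by rewrite -ltnNge; apply: lt; rewrite /lows sm // Um bm orbT.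
(* Choose a bad pair [e], [u] with the least [r u - r e]. Here [r e < r u], as otherwise the order
   of [e] before [u] in [x] would carry over to [y]. *)
case: (@arg_minnP _ eu0 bad (fun eu => r eu.2 - r eu.1) bad0).
case=> e u /and3P[/= le hu yue] emin.
have reu : r e < r u.
  rewrite ltnNge leq_eqVlt (inj_eq r_inj) eq_sym (negbTE (lh _ _ le hu)) /=.
  apply/negP => ue; have := xy ue; rewrite dx; last 2 first.
  - by case/andP: le.
  - by case/andP: hu.
  by move=> /(_ isT); clear -yue; lia.
have [re ru] := (rlow _ le, rhigh _ hu).
have bL : below_cut d e by case/andP: le.
have aL : above_cut d u by case/andP: hu.
have cu : ley c u.
  apply: IH; [clear -lek re ru reu ac; lia|clear -ru; lia|].
  by apply/depP; exists d.
have ea : ley e a.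
  apply: IH; [clear -lek re ru reu ac; lia|clear -re; lia|].
  by apply/depP; exists d.
(* The middle link goes from [u] to [e]: a path vertex [m] between them would make [(e, m)] or
   [(m, u)] a bad pair with a smaller gap. *)
apply: connect_trans cu (connect_trans _ ea).
apply/connect1/(dep_path (t := pos y e)) => // m bm.
have bcm : between c m a.
  by move: bm; rewrite !r_between; clear -re ru reu; lia.
have rm : r e < r m < r u by move: bm; rewrite r_between; clear -reu; lia.
rewrite on_path_vtx; case Um : (U m.+1).
  rewrite -leqNgt leqNgt; apply/negP => lt.
  have := emin (e, m); rewrite /bad /= le lt /highs sm' // Um bcm orbT.
  by move=> /(_ isT); clear -rm; lia.
rewrite -ltnNge ltnNge; apply/negP => ge.
have lm : lows m by rewrite /lows sm // Um bcm orbT.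
have := emin (m, u); rewrite /bad /= lm hu (leq_trans yue ge).
by move=> /(_ isT); clear -rm; lia.
Qed.

Lemma le_monotone c a : r a < r c -> lex c a -> ley c a.
Proof.
move=> ac h.
have /connectP[s] := le_down (triang_ofP U x) r_inj r_between h ac.
elim: s c {h ac} => [|p s IH] c /=; first by move=> _ ->; apply: connect0.
case/andP => /andP[d1 lt] ps e.
exact: connect_trans (dep_monotone lt d1) (IH p ps e).
Qed.
End Monotone.

Definition co_rank (p : 'I_n) : nat := n - p.

Lemma co_rank_inj : injective co_rank.
Proof.
move=> p q; rewrite /co_rank => e; apply: val_inj => /=.
by have := ltn_ord p; have := ltn_ord q; clear -e; lia.
Qed.

Lemma co_rank_lt p q : (co_rank p < co_rank q) = (q < p).
Proof. by rewrite /co_rank; have := ltn_ord p; have := ltn_ord q; lia. Qed.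

Lemma co_rank_between p m q : between p m q =
  (co_rank p < co_rank m < co_rank q) || (co_rank q < co_rank m < co_rank p).
Proof. by rewrite !co_rank_lt /between; lia. Qed.

Notation tr := (triang_of U).

(** The extremal linear extension has exactly the inversions that [dep T] forces, so lying above it
    means satisfying these relations. *)
Lemma exists_min T : ctriang U T -> exists x, tr x = T /\
  forall y, weak_le n x y <->
    forall a c, a < c -> connect (dep T) c a -> pos y c < pos y a.
Proof.
move=> cT; have [x [xd xi]] := extremal_perm cT val_inj val_between.
exists x; split; first exact: triang_of_dep.
move=> y; split=> [/weak_leP xy a c ac h|h].
  by apply: xy => //; rewrite (xi _ _ ac).
by apply/weak_leP => a c ac; rewrite (xi _ _ ac); apply: h.
Qed.

Lemma exists_max T : ctriang U T -> exists x, tr x = T /\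
  forall y, weak_le n y x <->
    forall a c, a < c -> connect (dep T) a c -> pos y a < pos y c.
Proof.
move=> cT; have [x [xd xi]] := extremal_perm cT co_rank_inj co_rank_between.
have lt_neq (a c : 'I_n) : a < c -> c != a by move=> ac; rewrite -val_eqE gtn_eqF.
exists x; split; first exact: triang_of_dep.
move=> y; split=> [/weak_leP yx a c ac h|h].
  have := xi c a; rewrite co_rank_lt ac h => /(_ isT) lt.
  have := yx a c ac; have := pos_neq y (lt_neq _ _ ac); clear -lt; lia.
apply/weak_leP => a c ac yca; have := xi c a; rewrite co_rank_lt ac => /(_ isT) xE.
rewrite ltnNge leq_eqVlt xE negb_or.
apply/andP; split.
  by apply: contraNneq (pos_neq x (lt_neq _ _ ac)) => ->.
by apply/negP => /(h _ _ ac); clear -yca; lia.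
Qed.

Lemma dep_le_pos x p q :
  connect (dep (tr x)) p q -> p != q -> pos x p < pos x q.
Proof.
case/connectP => s; elim: s p => [|p1 s IH] p /=.
  by move=> _ ->; rewrite eqxx.
case/andP=> /dep_triang_of lt ps e _.
have [p1q|ne] := eqVneq p1 q; first by rewrite -p1q.
exact: ltn_trans lt (IH _ ps e ne).
Qed.
End DepOrder.

(** * The fibres of the triangulation map *)

Section Kernel.
Variables (n : nat) (U : nat -> bool).
Notation vertex := 'I_n.+2.
Notation pair := (vertex * vertex)%type.
Implicit Types (x y w : 'S_n) (d e : pair) (p q m a b c : 'I_n) (T : {set pair}).
Local Notation dep := (dep U).
Local Notation tr := (@triang_of n U).

(** Beyond leastness of [xd] in the fibre, this includes that passing to the least element is
    monotone: inversions forced for [x] stay forced for [y], hence hold throughout the fibre of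
    [y]. *)
Lemma fiber_min x : exists xd, tr xd = tr x /\
  forall y y', weak_le n x y -> tr y' = tr y -> weak_le n xd y'.
Proof.
have [xd [e h]] := exists_min (triang_ofP U x); exists xd; split=> // y y' /weak_leP xy ey.
apply/h => a c ac /(le_monotone val_inj (@val_between n) xy ac).
by rewrite -ey => /dep_le_pos; apply; rewrite -val_eqE gtn_eqF.
Qed.

Lemma fiber_max y : exists yu, tr yu = tr y /\
  forall x x', weak_le n x y -> tr x' = tr x -> weak_le n x' yu.
Proof.
have [yu [e h]] := exists_max (triang_ofP U y); exists yu; split=> // x x' /weak_leP xy ex.
(* With the values numbered downwards, the weak order is reversed: pairs not inverted in [y] are not
   inverted in [x]. *)
have yx p q : co_rank p < co_rank q -> pos y q < pos y p -> pos x q < pos x p.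
  rewrite co_rank_lt => qp lt; have := xy q p qp.
  have := @pos_neq _ x p q; rewrite -val_eqE gtn_eqF // => /(_ isT).
  by clear -lt; lia.
apply/h => a c ac; have := ac; rewrite -co_rank_lt => ac'.
move=> /(le_monotone (@co_rank_inj n) (@co_rank_between n) yx ac').
by rewrite -ex => /dep_le_pos; apply; rewrite -val_eqE ltn_eqF.
Qed.

(** The least elements of the two fibres lie below each other, so they coincide. *)
Lemma class_anti x1 x2 y1 y2 : tr x1 = tr x2 -> tr y1 = tr y2 ->
  weak_le n x1 y1 -> weak_le n y2 x2 -> tr x1 = tr y1.
Proof.
move=> ex ey xy yx.
have [xd [exd hx]] := fiber_min x1; have [yd [eyd hy]] := fiber_min y2.
have -> : tr x1 = tr xd by [].
have -> : xd = yd.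
  apply: weak_le_anti; first by apply: hx xy _; rewrite eyd.
  by apply: hy yx _; rewrite exd.
by rewrite eyd.
Qed.

(** By monotonicity the least element of the fibre of [m] is below [y] and [z], hence below [m'],
    and symmetrically; then [class_anti] applies. Joins use greatest elements. *)
Lemma kernel_congruence : lattice_congruence n (fun x y => tr x = tr y).
Proof.
split=> [//|//|x y z -> //|x y z m m' e [mx mz mm] [my mz' mm']|
         x y z j j' e [jx jz jj] [jy jz' jj']].
  have [md [emd hm]] := fiber_min m; have [md' [emd' hm']] := fiber_min m'.
  rewrite -emd; apply: (class_anti (x2 := m) (y2 := md') emd (esym emd')).
    by apply: mm'; [apply: hm mx _|apply: hm mz _].
  by apply: mm; [apply: hm' my _|apply: hm' mz' _].
have [ju [eju hj]] := fiber_max j; have [ju' [eju' hj']] := fiber_max j'.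
apply/esym; rewrite -eju.
apply: (class_anti (x2 := ju') (y2 := j) (esym eju') eju).
  by apply: jj'; [apply: hj jx _|apply: hj jz _].
by apply: jj; [apply: hj' jy _|apply: hj' jz' _].
Qed.

(** A diagonal with [a] below and [c] above would have [b] strictly inside its span, and so require
    [b] after [a] if [b] is in U and before [c] if it is in D. As [w] does neither, no dependency is
    lost by the exchange. *)
Lemma witness_swap w a b c : swap_at w a c -> a < b -> b < c ->
  (pos w b < pos w a) = U b.+1 -> tr (w * tperm a c)%g = tr w.
Proof.
move=> [e ac] ab bc Ub; apply: triang_of_dep; first exact: triang_ofP.
move=> p q d; have lt := dep_triang_of d.
have [[ep eq]|ne1] := eqVneq (p, q) (a, c).
  subst p q; case/depP: d => d [dT ba cc].
  have [ddg /edgeP[dd hd]] : is_diag n U d /\ edge U w d.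
    by move: dT; rewrite inE => /andP.
  have sa : d.1 <= a.+1 <= d.2 by apply: (cut_span (U := U)); rewrite ?ba.
  have sc : d.1 <= c.+1 <= d.2 by apply: (cut_span (U := U)); rewrite ?cc ?orbT.
  have sb : d.1 < b.+1 < d.2 by clear -sa sc ab bc; lia.
  have nab := @pos_neq _ w b a; rewrite -val_eqE gtn_eqF // in nab.
  case UB : (U b.+1) Ub => Ub.
    by have := hd a b ba; rewrite /above_cut UB sb => /(_ isT); clear -Ub; lia.
  have := hd b c _ cc; rewrite /below_cut UB sb e => /(_ isT).
  by have := nab isT; clear -Ub; lia.
rewrite swap_order //; apply/eqP => -[ep eq]; subst p q.
by move: lt; rewrite e; clear; lia.
Qed.

Lemma camb_gen_triang x y : camb_gen n U x y -> tr x = tr y.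
Proof.
move/camb_genP => [a [b [c [ab bc -> ->]]]].
have lab : a < b by rewrite ab.
have lbc : b < c by rewrite bc.
have lac := ltn_trans lab lbc.
have nab : a != b by rewrite -val_eqE ltn_eqF.
have nbc : b != c by rewrite -val_eqE ltn_eqF.
have nac : a != c by rewrite -val_eqE ltn_eqF.
have [nba nca] : b != a /\ c != a by split; rewrite eq_sym.
have tE (u v p : 'I_n) : pos (tperm u v) p = tperm u v p.
  by rewrite /pos tpermV.
apply/esym; apply: (witness_swap (b := b)) => //.
  split=> //; case: (U _); rewrite !tE; first by rewrite tpermL (tpermD nac nbc).
  by rewrite tpermR (tpermD nba nca).
case: (U _); rewrite !tE; first by rewrite tpermL tpermR lab.
by rewrite tpermL (tpermD nba nca) ltnNge ltnW.
Qed.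

(** Descend from any element of the fibre to its least element by covers. They stay in the fibre,
    and each of them is contracted by [th]. *)
Lemma triang_eq_cong th x y : lattice_congruence n th ->
  (forall z w, camb_gen n U z w -> th z w) -> tr x = tr y -> th x y.
Proof.
move=> cth gth exy.
have [xd [exd hd]] := fiber_min x.
suff K z : tr z = tr xd -> th z xd.
  apply: cong_trans (K x (esym exd)) (cong_sym cth (K y _)) => //.
  by rewrite exd.
have [k] := ubnP #|inv_set n z|; elim: k z => // k IH z lek ez.
have [->|ne] := eqVneq z xd; first exact: cong_refl.
have dz : weak_le n xd z by apply: (hd x) => //; [apply: weak_le_refl|rewrite ez].
have [a [c [ac e nxd]]] := exists_descent dz (fun h => negP ne (introT eqP h)).
set w := (z * tperm a c)%g.
have zE : z = (w * tperm a c)%g by rewrite /w -mulgA tperm2 mulg1.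
have sw : swap_at w a c by split=> //; rewrite !pos_swap tpermL tpermR.
have iz : inv_set n z = (a, c) |: inv_set n w.
  by rewrite {1}zE; apply: inv_swap => //; case: sw.
have acw : (a, c) \notin inv_set n w.
  by rewrite inv_setE; case: sw => -> _; clear; lia.
have dw : weak_le n xd w.
  apply/subsetP => d dd; have := subsetP dz d dd; rewrite iz in_setU1.
  by case/orP => // /eqP ed; rewrite -ed dd in nxd.
have ew : tr w = tr xd.
  apply/esym; apply: (class_anti (x2 := z) (y2 := w)) => //.
  by rewrite /weak_le iz subsetUr.
have ndep : ~~ dep (tr z) c a.
  by apply: contra nxd; rewrite ez inv_setE ac => /dep_triang_of.
(* Since [c] need not precede [a] in this fibre, the path between reading [c] and [a] has a vertex
   [m] between them. This is the witness for [forcing]: read before if it is in U, after if it is in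
   D. *)
have [m /andP[bm pm]|no] :=
    pickP (fun m => between c m a && on_path U z (pos z a) (vtx m)); last first.
  case/negP: ndep; apply: (dep_path (t := pos z a)) => //; first by rewrite e.
  by move=> m bm; have := no m; rewrite bm /= => ->.
have ma : m != a by apply: contraTneq bm => ->; rewrite /between !ltnn andbF.
have mc : m != c by apply: contraTneq bm => ->; rewrite /between !ltnn andbF.
have th1 : th w z.
  suff h : th w (w * tperm a c)%g by rewrite -zE in h.
  apply: (forcing cth gth (b := m)) => //.
  - by move: bm; rewrite /between; clear -ac; lia.
  - by move: bm; rewrite /between; clear -ac; lia.
  rewrite !pos_swap tpermL tpermD; [|by rewrite eq_sym|by rewrite eq_sym].
  have := pos_neq z mc; move: pm; rewrite on_path_vtx e.
  by case: (U _); clear; lia.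
apply: cong_trans (cong_sym cth th1) (IH w _ ew) => //.
by move: lek; rewrite iz cardsU1 acw; clear; lia.
Qed.

Lemma triang_eqP x y : tr x = tr y <-> cambrian_cong n U x y.
Proof.
split=> [e th cth gth|h]; first exact: triang_eq_cong.
exact: h kernel_congruence camb_gen_triang.
Qed.

Lemma cambrian_leP x y : cambrian_le n U x y <->
  exists x' y', [/\ tr x = tr x', tr y = tr y' & weak_le n x' y'].
Proof.
by split=> -[x' [y' [/triang_eqP h1 /triang_eqP h2 h3]]]; exists x', y'; split.
Qed.

Lemma cambrian_le_trans y x z :
  cambrian_le n U x y -> cambrian_le n U y z -> cambrian_le n U x z.
Proof.
move=> /cambrian_leP[x1 [y1 [ex ey xy]]] /cambrian_leP[y2 [z2 [ey2 ez yz]]].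
have [xd [exd hx]] := fiber_min x1; apply/cambrian_leP; exists xd, z2.
split=> //; first by rewrite exd.
by apply: weak_le_trans yz; apply: hx xy _; rewrite -ey2.
Qed.
End Kernel.

(** * Diagonal flips *)

Section Flips.
Variables (n : nat) (U : nat -> bool).
Notation vertex := 'I_n.+2.
Notation pair := (vertex * vertex)%type.
Implicit Types (x y z w : 'S_n) (d e : pair) (p q m : 'I_n) (T : {set pair}).
Local Notation edge := (edge U).
Local Notation on_path := (on_path U).
Local Notation path_step := (path_step U).
Local Notation below_cut := (below_cut U).
Local Notation above_cut := (above_cut U).
Local Notation tr := (@triang_of n U).

Lemma swap_edge x p q d : pos x q = (pos x p).+1 -> edge x d ->
  ~~ (below_cut d p && above_cut d q) -> edge (x * tperm p q)%g d.
Proof.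
move=> e /edgeP[dd h] nc; apply/edgeP; split=> // u v bu av.
have lt := h u v bu av.
rewrite swap_order //; apply: contraNneq nc => -[eu ev]; subst u v.
  by rewrite bu av.
by move: lt; rewrite e; clear; lia.
Qed.

(** Labels below [d] are read before [q] and labels above it after [p], so the path between these
    consecutive letters has [d] as a step. *)
Lemma edge_path_step x p q d : pos x q = (pos x p).+1 -> edge x d ->
  below_cut d p -> above_cut d q -> path_step x (pos x q) d.
Proof.
move=> e /edgeP[dd h] bp aq.
have endp (i : vertex) : (i == d.1) || (i == d.2) -> on_path x (pos x q) i.
  move=> id; have [i0|i0] := eqVneq (i : nat) 0; first exact: on_path0.
  have [i1|i1] := eqVneq (i : nat) n.+1; first exact: on_pathn.
  have [k ik] : exists k, i = vtx k.
    by apply: vtxP; have := ltn_ord i; clear -i0 i1; lia.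
  have id' : (k.+1 == d.1) || (k.+1 == d.2) by move: id; rewrite ik -!val_eqE.
  rewrite ik on_path_vtx; case Uk : (U k.+1).
    by apply: h => //; rewrite /below_cut Uk.
  have := h p k bp; rewrite /above_cut Uk e; exact.
split=> //; [by apply: endp; rewrite eqxx|by apply: endp; rewrite eqxx orbT|].
move=> i i1 i2; have [k ik] : exists k, i = vtx k.
  by apply: vtxP; have := ltn_ord d.2; clear -i1 i2; lia.
rewrite ik vtxE in i1 i2; rewrite ik on_path_vtx; case Uk : (U k.+1).
  by have := h p k bp; rewrite /above_cut Uk i1 i2 e -leqNgt; exact.
by have := h k q; rewrite /below_cut Uk i1 i2 -ltnNge; apply.
Qed.

Lemma path_step_uniq x t d e (u v : nat) : path_step x t d -> path_step x t e ->
  u < v -> d.1 <= u -> v <= d.2 -> e.1 <= u -> v <= e.2 -> d = e.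
Proof.
case: d e => [d1 d2] [e1 e2] [/= dd pd1 pd2 nd] [/= ee pe1 pe2 ne] uv h1 h2 h3 h4.
have E1 : d1 = e1.
  apply: val_inj => /=; case: (ltngtP d1 e1) => // lt.
    by have := nd e1 lt; rewrite pe1 => h; have := h (leq_ltn_trans h3 (leq_trans uv h2)).
  by have := ne d1 lt; rewrite pd1 => h; have := h (leq_ltn_trans h1 (leq_trans uv h4)).
have E2 : d2 = e2.
  apply: val_inj => /=; case: (ltngtP d2 e2) => // lt.
    by have := ne d2; rewrite pd2 lt => h; have := h (leq_ltn_trans h3 (leq_trans uv h2)) isT.
  by have := nd e2; rewrite pe2 lt => h; have := h (leq_ltn_trans h1 (leq_trans uv h4)) isT.
by rewrite E1 E2.
Qed.

Definition edge_sym x (i j : vertex) := edge x (i, j) || edge x (j, i).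

(* A cover p q -> q p of the weak order that is not contracted replaces the *)
(* diagonal ac by the diagonal be of a quadrilateral with vertex set        *)
(* {l, p, q, r}; which diagonal is which depends on the sides of p and q.    *)
Definition quad_a (l : vertex) p : vertex := if U p.+1 then vtx p else l.
Definition quad_c q (r : vertex) : vertex := if U q.+1 then r else vtx q.
Definition quad_b (l : vertex) p : vertex := if U p.+1 then l else vtx p.
Definition quad_e q (r : vertex) : vertex := if U q.+1 then vtx q else r.

Definition quad_sides z (a c b e : vertex) :=
  [/\ edge_sym z a b, edge_sym z b c, edge_sym z a e & edge_sym z e c].

Section Cover.
Variables (x : 'S_n) (p q : 'I_n).
Hypothesis pq : p < q.
Hypothesis succ_pq : pos x q = (pos x p).+1.
Hypothesis free_pq :
  forall m, between p m q -> ~~ on_path x (pos x q) (vtx m).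
Let y := (x * tperm p q)%g.
Let t := pos x q.

(** The vertices [l] and [r] are the path vertices nearest to [p] on the left and to [q] on the
    right; between them only [p] and [q] can be on the path. *)
Lemma cover_quad : exists l r : vertex, [/\ l < p.+1, q.+1 < r,
  path_step x t (quad_a l p, quad_c q r), path_step y t (quad_b l p, quad_e q r) &
  forall z, z = x \/ z = y ->
    quad_sides z (quad_a l p) (quad_c q r) (quad_b l p) (quad_e q r)].
Proof.
pose P (k : vertex) := on_path x t k && (k < p.+1).
pose Q (k : vertex) := on_path x t k && (q.+1 < k).
have P0 : P ord0 by rewrite /P on_path0.
have Qn : Q ord_max by rewrite /Q on_pathn //= ltnS.
case: (@arg_maxnP _ ord0 P (@nat_of_ord _) P0) => l /andP[pl lp] lmax.
case: (@arg_minnP _ ord_max Q (@nat_of_ord _) Qn) => r /andP[pr rq] rmin.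
exists l, r.
have npq : p != q by rewrite -val_eqE ltn_eqF.
have ey m : m != p -> m != q -> pos y m = pos x m.
  by move=> h1 h2; rewrite pos_swap tpermD // eq_sym.
have yp : pos y p = t by rewrite pos_swap tpermL.
have yq : pos y q = pos x p by rewrite pos_swap tpermR.
(* From time [t.-1] to [t.+1], the paths of [x] and [y] can differ from the path of [x] at time [t]
   only in the vertices of [p] and [q]. *)
pose quiet z s := forall i, i != vtx p -> i != vtx q -> on_path z s i = on_path x t i.
have quietP z s : z = x \/ z = y -> t.-1 <= s <= t.+1 -> quiet z s.
  move=> zx st i ip iq; rewrite /on_path; congr [|| _, _ | _].
  apply: eq_existsb => m; have [im|//] := eqVneq i (vtx m); rewrite ?andbF //=.
  have mp : m != p by apply: contraNneq ip => <-; rewrite im.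
  have mq : m != q by apply: contraNneq iq => <-; rewrite im.
  have -> : pos z m = pos x m by case: zx => ->; rewrite ?ey.
  have := pos_neq x mp; have := pos_neq x mq; move: st; rewrite /t succ_pq.
  by case: (U _); clear; lia.
have step z s (i j : vertex) : quiet z s -> l <= i -> j <= r -> i < j ->
    on_path z s i -> on_path z s j ->
    (i < vtx p -> vtx p < j -> ~~ on_path z s (vtx p)) ->
    (i < vtx q -> vtx q < j -> ~~ on_path z s (vtx q)) -> path_step z s (i, j).
  move=> qz li jr ij pi pj np nq; split=> //= k ik kj.
  have [kp|kp] := eqVneq k (vtx p); first by rewrite kp in ik kj *; apply: np.
  have [kq|kq] := eqVneq k (vtx q); first by rewrite kq in ik kj *; apply: nq.
  rewrite qz //; apply/negP => pk.
  move: kp kq; rewrite -!val_eqE => kp kq.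
  have k1 : (p.+1 < k).
    rewrite ltnNge leq_eqVlt (negbTE kp) /=; apply/negP => lt.
    by have := lmax k; rewrite /P pk lt => /(_ isT) /=; clear -li ik; lia.
  have k2 : (k < q.+1).
    rewrite ltnNge leq_eqVlt eq_sym (negbTE kq) /=; apply/negP => lt.
    by have := rmin k; rewrite /Q pk lt => /(_ isT) /=; clear -jr kj; lia.
  have [m km] : exists m, k = vtx m.
    by apply: vtxP; have := ltn_ord q; clear -k1 k2; lia.
  move: k1 k2 pk; rewrite km vtxE !ltnS => k1 k2 pk.
  by have := @free_pq m; rewrite /between k1 k2 pk => /(_ isT).
have lP : l <= vtx p by apply: ltnW.
have lQ : l < vtx q by apply: ltn_trans lp _.
have rQ : vtx q <= r by apply: ltnW.
have rP : vtx p < r by apply: ltn_trans rq.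
have nl : l != vtx p /\ l != vtx q by rewrite -!val_eqE !ltn_eqF.
have nr : r != vtx p /\ r != vtx q by rewrite -!val_eqE !gtn_eqF.
have table z s (bp bq : bool) : quiet z s ->
    on_path z s (vtx p) = bp -> on_path z s (vtx q) = bq ->
  [/\ bp -> path_step z s (l, vtx p), bq -> path_step z s (vtx q, r),
     bp && bq -> path_step z s (vtx p, vtx q) &
    [/\ bp && ~~ bq -> path_step z s (vtx p, r),
        ~~ bp && bq -> path_step z s (l, vtx q) &
        ~~ bp && ~~ bq -> path_step z s (l, r)]].
  move=> qz ep eq.
  have pl' : on_path z s l by case: nl => *; rewrite qz.
  have pr' : on_path z s r by case: nr => *; rewrite qz.
  split; [|..|split]; move=> b; apply: step => //;
    rewrite ?ep ?eq; case: bp bq b {ep eq} => -[] // _; rewrite ?vtxE;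
    try (clear -pq lp rq; lia).
have onx s : (on_path x s (vtx p) = if U p.+1 then pos x p < s else s <= pos x p) *
    (on_path x s (vtx q) = if U q.+1 then pos x q < s else s <= pos x q).
  by rewrite !on_path_vtx.
have ony s : (on_path y s (vtx p) = if U p.+1 then pos y p < s else s <= pos y p) *
    (on_path y s (vtx q) = if U q.+1 then pos y q < s else s <= pos y q).
  by rewrite !on_path_vtx.
have tE : t = (pos x p).+1 by [].
have X0 : on_path x t (vtx p) = U p.+1 /\ on_path x t (vtx q) = ~~ U q.+1.
  by rewrite !onx -/t tE; case: (U p.+1); case: (U q.+1); clear; split; lia.
have Y0 : on_path y t (vtx p) = ~~ U p.+1 /\ on_path y t (vtx q) = U q.+1.
  by rewrite !ony yp yq tE; case: (U p.+1); case: (U q.+1); clear; split; lia.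
(* Both permutations have read neither letter at [t.-1] and both letters at [t.+1]. The four sides
   are steps of these common paths; the diagonals come from time [t]. *)
have early z : z = x \/ z = y ->
    on_path z t.-1 (vtx p) = ~~ U p.+1 /\ on_path z t.-1 (vtx q) = ~~ U q.+1.
  by case=> ->; rewrite ?onx ?ony ?yp ?yq -/t tE;
     case: (U p.+1); case: (U q.+1); clear; split; lia.
have late z : z = x \/ z = y ->
    on_path z t.+1 (vtx p) = U p.+1 /\ on_path z t.+1 (vtx q) = U q.+1.
  by case=> ->; rewrite ?onx ?ony ?yp ?yq -/t tE;
     case: (U p.+1); case: (U q.+1); clear; split; lia.
have Tx := table x t _ _ (quietP x t (or_introl erefl) _) X0.1 X0.2.
have Ty := table y t _ _ (quietP y t (or_intror erefl) _) Y0.1 Y0.2.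
have ft : t.-1 <= t <= t.+1 by clear; lia.
have ft0 : t.-1 <= t.-1 <= t.+1 by clear; lia.
have ft1 : t.-1 <= t.+1 <= t.+1 by clear; lia.
have [T1 T2 T3 [T4 T5 T6]] := Tx ft; have [S1 S2 S3 [S4 S5 S6]] := Ty ft.
rewrite /quad_a /quad_b /quad_c /quad_e; split=> //.
- by move: T1 T2 T3 T4 T5 T6; case: (U p.+1); case: (U q.+1); auto.
- by move: S1 S2 S3 S4 S5 S6; case: (U p.+1); case: (U q.+1); auto.
move=> z zxy.
have [A1 A2 A3 [A4 A5 A6]] :=
  table z _ _ _ (quietP z t.-1 zxy ft0) (early z zxy).1 (early z zxy).2.
have [B1 B2 B3 [B4 B5 B6]] :=
  table z _ _ _ (quietP z t.+1 zxy ft1) (late z zxy).1 (late z zxy).2.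
move: A1 A2 A3 A4 A5 A6 B1 B2 B3 B4 B5 B6.
case: (U p.+1); case: (U q.+1) => /= *;
  repeat match goal with H : is_true true -> path_step _ _ _ |- _ =>
    have := path_step_edge (H isT); clear H end => *;
  split; rewrite /edge_sym; match goal with
  | H : is_true (edge _ ?d) |- is_true (edge _ ?d || _) => by rewrite H
  | H : is_true (edge _ ?d) |- is_true (_ || edge _ ?d) => by rewrite H orbT
  end.
Qed.
End Cover.

(** Exchanging [p] and [q] can only destroy an edge with [p] below and [q] above, and such an edge
    is the unique step over both labels at that time. The same holds backwards. *)
Lemma cover_triang x p q (a c b e : vertex) : pos x q = (pos x p).+1 ->
  let y := (x * tperm p q)%g in
  path_step x (pos x q) (a, c) -> path_step y (pos x q) (b, e) ->
  a <= p.+1 <= c -> a <= q.+1 <= c -> b <= p.+1 <= e -> b <= q.+1 <= e ->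
  [/\ (a, c) \in tr x, (b, e) \in tr y &
      tr y = (tr x :\ (a, c)) :|: [set (b, e)]].
Proof.
move=> succ y sx sy ap aq bp bq.
have yp : pos y p = pos x q by rewrite pos_swap tpermL.
have yq : pos y q = pos x p by rewrite pos_swap tpermR.
have succ' : pos y p = (pos y q).+1 by rewrite yp yq.
have xy : x = (y * tperm q p)%g by rewrite tpermC /y -mulgA tperm2 mulg1.
have npq : p != q by apply/eqP => e1; move: succ; rewrite e1; clear; lia.
have c1 : below_cut (a, c) p by rewrite (path_step_cut sx ap) succ ltnSn.
have c2 : above_cut (a, c) q by rewrite (path_step_cut sx aq) leqnn.
have c3 : below_cut (b, e) q by rewrite (path_step_cut sy bq) yq succ ltnSn.
have c4 : above_cut (b, e) p by rewrite (path_step_cut sy bp) yp leqnn.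
have acx : (a, c) \in tr x.
  rewrite inE (path_step_edge sx) andbT; apply/is_diagP.
  by split; [case: sx|exists p|exists q].
have bey : (b, e) \in tr y.
  rewrite inE (path_step_edge sy) andbT; apply/is_diagP.
  by split; [case: sy|exists q|exists p].
split=> //; apply/setP => d; rewrite in_setU in_setD1 in_set1.
have uniq w s (d1 d2 : pair) : path_step w s d1 -> path_step w s d2 ->
    d1.1 <= p.+1 <= d1.2 -> d1.1 <= q.+1 <= d1.2 ->
    d2.1 <= p.+1 <= d2.2 -> d2.1 <= q.+1 <= d2.2 -> d1 = d2.
  move=> s1 s2 /andP[? ?] /andP[? ?] /andP[? ?] /andP[? ?].
  case: (ltngtP p q) => [lt|lt|/val_inj e1]; last by rewrite e1 eqxx in npq.
    exact: (path_step_uniq (u := p.+1) (v := q.+1) s1 s2).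
  exact: (path_step_uniq (u := q.+1) (v := p.+1) s1 s2).
have spans (d' : pair) p' q' : below_cut d' p' -> above_cut d' q' -> d'.1 < d'.2 ->
    d'.1 <= p'.+1 <= d'.2 /\ d'.1 <= q'.+1 <= d'.2.
  by move=> h1 h2 h3; split; apply: (cut_span (U := U)); rewrite ?h1 ?h2 ?orbT.
apply/idP/idP => [dy|/orP[/andP[dac dx]|/eqP-> //]].
  have [//|dbe] := eqVneq d (b, e); first by rewrite orbT.
  rewrite orbF; move: (dy); rewrite !inE => /andP[ddg dye].
  apply/andP; split.
    apply: contraTneq dye => ->; apply/negP => /edgeP[_ h].
    by have := h _ _ c1 c2; rewrite yp yq succ; clear; lia.
  rewrite ddg xy; apply: (swap_edge succ' dye); apply: contra dbe => /andP[h1 h2].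
  have [g1 g2] := spans d q p h1 h2 (edge_lt dye).
  apply/eqP; apply: (uniq y (pos y p)) => //; last by rewrite yp.
  exact: edge_path_step succ' dye h1 h2.
move: dx; rewrite !inE => /andP[ddg dxe]; rewrite ddg /=.
apply: (swap_edge succ dxe); apply: contra dac => /andP[h1 h2].
have [g1 g2] := spans d p q h1 h2 (edge_lt dxe).
apply/eqP; apply: (uniq x (pos x q)) => //.
exact: edge_path_step succ dxe h1 h2.
Qed.

Lemma quad_spans (l r : vertex) p q : p < q -> l < p.+1 -> q.+1 < r ->
  [/\ quad_a l p <= p.+1 <= quad_c q r, quad_a l p <= q.+1 <= quad_c q r,
      quad_b l p <= p.+1 <= quad_e q r & quad_b l p <= q.+1 <= quad_e q r].
Proof.
rewrite /quad_a /quad_b /quad_c /quad_e => pq lp rq.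
by case: (U p.+1); case: (U q.+1); rewrite ?vtxE; split; clear -pq lp rq; lia.
Qed.

Lemma adjacent_edge x d : d.1 < d.2 -> adjacent n U d.1 d.2 -> edge x d.
Proof.
move=> dd; rewrite adjacentE // => h; apply/edgeP; split=> // p q bp aq.
by case/orP: h => /forallP h; [have := h q|have := h p]; rewrite ?aq ?bp.
Qed.

Lemma linkedE x (i j : vertex) : linked n U (tr x) i j = edge_sym x i j.
Proof.
have K (u v : vertex) : (u < v) && (adjacent n U u v || ((u, v) \in tr x)) = edge x (u, v).
  rewrite inE /is_diag /=; have [uv|uv] /= := ltnP u v; last first.
    by apply/esym/negbTE/negP => /edge_lt /=; clear -uv; lia.
  have [ad|//] := boolP (adjacent n U u v).
  by apply/esym/(@adjacent_edge x (u, v)).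
by rewrite /linked !K.
Qed.

(* Places the last label below f and the first label above f next to each  *)
(* other: the labels processed in between lie outside the span of f, and   *)
(* they can be moved before p or after q.                                   *)
Lemma make_consecutive x (f : pair) : f \in tr x -> exists p q x',
  [/\ tr x' = tr x, pos x' q = (pos x' p).+1, below_cut f p & above_cut f q].
Proof.
move=> fx; have := fx; rewrite inE => /andP[/is_diagP[ff [p0 bp0] [q0 aq0]]].
move=> /edgeP[_ hf].
case: (@arg_maxnP _ p0 (below_cut f) (pos x) bp0) => p bp pmax.
case: (@arg_minnP _ q0 (above_cut f) (pos x) aq0) => q aq qmin.
have pq := hf _ _ bp aq.
have sp : f.1 <= p.+1 <= f.2 by apply: (cut_span (U := U)); rewrite ?bp.
have sq : f.1 <= q.+1 <= f.2 by apply: (cut_span (U := U)); rewrite ?aq ?orbT.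
pose mid m := pos x p < pos x m < pos x q.
have mid_out m : mid m -> m.+1 < f.1 \/ f.2 < m.+1.
  move=> /andP[h1 h2]; case: (ltnP m.+1 f.1) => h3; first by left.
  case: (ltnP f.2 m.+1) => h4; first by right.
  have /orP[bm|am] : below_cut f m || above_cut f m by apply: span_cut; rewrite h3.
    by have := pmax m bm; clear -h1; lia.
  by have := qmin m am; clear -h2; lia.
(* The letters to be moved in front of [p]: those beyond the far end of [f] when [p] is an end of
   [f], and all of them when [p] is an inner label. The rest go behind [q]. *)
pose S m := mid m && [&& (p.+1 != f.1) || (f.2 < m.+1) & (p.+1 != f.2) || (m.+1 < f.1)].
(* An end of [f] strictly inside such a [d] would be forced after [p] although it is below [f], or
   before [q] although it is above. Each reversed dependency below would need such a [d]. *)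
have no_inner d u v (k : 'I_n) : d \in tr x -> below_cut d u -> above_cut d v ->
    pos x p <= pos x u -> pos x v <= pos x q -> (k.+1 == f.1) || (k.+1 == f.2) ->
    ~~ (d.1 < k.+1 < d.2).
  rewrite inE => /andP[_ /edgeP[_ hd]] bu av pu vq kf; apply/negP => kd.
  case Uk : (U k.+1).
    have bk : below_cut f k by rewrite /below_cut Uk.
    have := pmax k bk; have := hd u k bu; rewrite /above_cut Uk kd => /(_ isT).
    by clear -pu; lia.
  have ak : above_cut f k by rewrite /above_cut Uk.
  have := qmin k ak; have := hd k v _ av; rewrite /below_cut Uk kd => /(_ isT).
  by clear -vq; lia.
have inner1 d u v : d \in tr x -> below_cut d u -> above_cut d v ->
    pos x p <= pos x u -> pos x v <= pos x q -> ~~ (d.1 < f.1 < d.2).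
  move=> dT bu av pu vq; apply/negP => h.
  have [k fk] : exists k, f.1 = vtx k.
    by apply: vtxP; have := ltn_ord d.2; clear -h; lia.
  by have := no_inner d u v k dT bu av pu vq; rewrite fk vtxE in h *; rewrite eqxx h => /(_ isT).
have inner2 d u v : d \in tr x -> below_cut d u -> above_cut d v ->
    pos x p <= pos x u -> pos x v <= pos x q -> ~~ (d.1 < f.2 < d.2).
  move=> dT bu av pu vq; apply/negP => h.
  have [k fk] : exists k, f.2 = vtx k.
    by apply: vtxP; have := ltn_ord d.2; clear -h; lia.
  by have := no_inner d u v k dT bu av pu vq; rewrite fk vtxE in h *; rewrite eqxx orbT h => /(_ isT).
have npq : q != p by apply: contraTneq pq => ->; rewrite ltnn.
pose K (m : 'I_n) : nat := if pos x m < pos x p then 0 else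
  if pos x q < pos x m then 5 else
  if m == p then 2 else if m == q then 3 else if S m then 1 else 4.
have Kp : K p = 2 by rewrite /K ltnn ltnNge (ltnW pq) eqxx.
have Kq : K q = 3 by rewrite /K ltnn ltnNge (ltnW pq) (negbTE npq) eqxx.
have Kcase m : [\/ m = p, m = q, pos x m < pos x p /\ K m = 0 |
    [\/ pos x q < pos x m /\ K m = 5, [/\ mid m, S m & K m = 1] |
      [/\ mid m, ~~ S m & K m = 4]]].
  have [->|mp] := eqVneq m p; first by constructor 1.
  have [->|mq] := eqVneq m q; first by constructor 2.
  have [h|h] := ltnP (pos x m) (pos x p); first by constructor 3; rewrite /K h.
  constructor 4; have [h'|h'] := ltnP (pos x q) (pos x m).
    by constructor 1; rewrite /K ltnNge h h'.
  have mm : mid m.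
    by rewrite /mid !ltn_neqAle h h' !pos_neq // eq_sym.
  have E : K m = if S m then 1 else 4.
    by rewrite /K ltnNge h ltnNge h' (negbTE mp) (negbTE mq).
  by case Sm : (S m) E; [constructor 2|constructor 3].
pose L u v := (K u < K v) || (K u == K v) && (pos x u < pos x v).
have [x' x'L] : exists x' : 'S_n, forall u v, (pos x' u < pos x' v) = L u v.
  apply: perm_of_order => [u|v u s|u v /(pos_neq x)]; rewrite /L; clear; lia.
exists p, q, x'; split=> //; last first.
  apply: pos_succ; first by rewrite x'L /L Kp Kq.
  move=> v; rewrite !x'L /L Kp Kq.
  by case: (Kcase v) => [->|->|[_ ->]|[[_ ->]|[_ _ ->]|[_ _ ->]]];
    rewrite ?Kp ?Kq ?ltnn //.
apply: triang_of_dep; first exact: triang_ofP.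
move=> u v; rewrite x'L /L => duv; have lt := dep_triang_of duv.
case/depP: duv => d [dT bu av].
have dd : d.1 < d.2 by move: dT; rewrite inE => /andP[_ /edge_lt].
have su : d.1 <= u.+1 <= d.2 by apply: (cut_span (U := U)); rewrite ?bu.
have sv : d.1 <= v.+1 <= d.2 by apply: (cut_span (U := U)); rewrite ?av ?orbT.
have I1 := inner1 d u v dT bu av; have I2 := inner2 d u v dT bu av.
have nu : u != v by apply: contraTneq lt => ->; rewrite ltnn.
move: npq nu; rewrite -!val_eqE => npq nu.
have fin : pos x p <= pos x u -> pos x v <= pos x q ->
    (d.1 < f.1 < d.2) || (d.1 < f.2 < d.2) -> False.
  by move=> h1 h2; rewrite (negbTE (I1 h1 h2)) (negbTE (I2 h1 h2)).
case: (Kcase u) => [eu|eu|[hu ->]|[[hu ->]|[hu Su ->]|[hu Su ->]]];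
case: (Kcase v) => [ev|ev|[hv ->]|[[hv ->]|[hv Sv ->]|[hv Sv ->]]];
  rewrite ?eu ?ev ?Kp ?Kq //= ?lt ?orbT //; exfalso;
  try (subst u); try (subst v); try (move: hu hv lt pq; rewrite /mid; clear; lia).
all: try (move: hu lt pq; rewrite /mid; clear; lia).
all: try (move: hv lt pq; rewrite /mid; clear; lia).
all: try (move: lt pq; clear; lia).
- have mv := mid_out v hv; move: Sv; rewrite /S hv /= => Sv.
  apply: fin => //; first by case/andP: hv => _ /ltnW.
  by clear -ff dd mv Sv sp su sv; lia.
- have mu := mid_out u hu; move: Su; rewrite /S hu /= => Su.
  apply: fin => //; first by case/andP: hu => /ltnW.
  have npq' : (q : nat) != p := npq; clear -ff dd mu Su sp sq su sv npq'; lia.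
have mu := mid_out u hu; have mv := mid_out v hv.
move: Su Sv; rewrite /S hu hv /= => Su Sv.
apply: fin; [by case/andP: hu => /ltnW|by case/andP: hv => _ /ltnW|].
by clear -ff dd mu mv Su Sv sp su sv; lia.
Qed.

(** The side of the line through [a] and [c] on which [f] lies. Beyond an end it is decided by that
    end: by convexity the line passes above the vertices beyond an upper one. *)
Definition above_line (a c f : vertex) : bool :=
  if f < a then ~~ U a else if f < c then U f else ~~ U c.

(** Two triangles over the chord on the same side would overlap: for every position of [f1] and [f2]
    relative to [a] and [c], some of the four edges would cross. *)
Lemma same_side_neighbours x (a c f1 f2 : vertex) : a < c -> f1 < f2 ->
  edge_sym x a f1 -> edge_sym x c f1 -> edge_sym x a f2 -> edge_sym x c f2 ->
  above_line a c f1 = above_line a c f2 -> False.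
Proof.
move=> ac f12 a1 c1 a2 c2; rewrite /above_line.
have asc (i j : vertex) : i < j -> edge_sym x i j -> edge x (i, j).
  by move=> ij /orP[//|/edge_lt /= ji]; move: ij; rewrite ltnNge ltnW.
have dsc (i j : vertex) : i < j -> edge_sym x j i -> edge x (i, j).
  by rewrite /edge_sym orbC; apply: asc.
have interleaved (i j k l : vertex) : edge x (i, k) -> edge x (j, l) ->
    i < j -> j < k -> k < l -> U j != U k.
  move=> h1 h2 ij jk kl; have := edge_noncrossing h1 h2.
  by rewrite /crosses /= ij jk kl /= negb_or => /andP[].
have nested (i j k l : vertex) : edge x (i, l) -> edge x (j, k) ->
    i < j -> k < l -> U j = U k.
  move=> h1 h2 ij kl; have := edge_noncrossing h1 h2.
  by rewrite /crosses /= ij kl /= !negb_or negbK => /and4P[_ _ /eqP].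
have ne (i j : vertex) : edge_sym x i j -> (i == j :> nat) = false.
  by case/orP => /edge_lt /= h; [rewrite ltn_eqF|rewrite gtn_eqF].
have [l2|r2|/eqP] := ltngtP f2 a; last by rewrite eq_sym ne.
  have l1 := ltn_trans f12 l2; rewrite l1 => _.
  have l1c := ltn_trans l1 ac; have l2c := ltn_trans l2 ac.
  have /eqP := interleaved _ _ _ _ (dsc _ _ l1 a1) (dsc _ _ l2c c2) f12 l2 ac.
  by apply; apply: nested (dsc _ _ l1c c1) (dsc _ _ l2 a2) f12 ac.
have [l1|r1|/eqP] := ltngtP f1 a; last by rewrite eq_sym ne.
  have l1c := ltn_trans l1 ac.
  have [i2|o2|/eqP] := ltngtP f2 c; last by rewrite eq_sym ne.
    by rewrite -(nested _ _ _ _ (dsc _ _ l1c c1) (asc _ _ r2 a2) l1 i2); case: (U a).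
  have := interleaved _ _ _ _ (dsc _ _ l1c c1) (asc _ _ r2 a2) l1 ac o2.
  by move=> ne_ac h; rewrite -(inj_eq negb_inj) h eqxx in ne_ac.
have [i2|o2|/eqP] := ltngtP f2 c; last by rewrite eq_sym ne.
  rewrite (ltn_trans f12 i2) => h.
  have := interleaved _ _ _ _ (asc _ _ r2 a2) (dsc _ _ (ltn_trans f12 i2) c1) r1 f12 i2.
  by rewrite h eqxx.
have [i1|o1|/eqP] := ltngtP f1 c; last by rewrite eq_sym ne.
  by rewrite (nested _ _ _ _ (asc _ _ r2 a2) (dsc _ _ i1 c1) r1 o2); case: (U c).
move=> _; have /eqP := interleaved _ _ _ _ (asc _ _ r1 a1) (asc _ _ o2 c2) ac o1 f12.
by apply; apply: nested (asc _ _ r2 a2) (asc _ _ o1 c1) ac f12.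
Qed.

Lemma common_neighbours x (a c f1 f2 f3 : vertex) : a < c ->
  edge_sym x a f1 -> edge_sym x c f1 -> edge_sym x a f2 -> edge_sym x c f2 ->
  edge_sym x a f3 -> edge_sym x c f3 -> [\/ f1 = f2, f1 = f3 | f2 = f3].
Proof.
move=> ac.
have same (u v : vertex) : edge_sym x a u -> edge_sym x c u ->
    edge_sym x a v -> edge_sym x c v -> above_line a c u = above_line a c v -> u = v.
  move=> au cu av cv h; have [uv|vu|/val_inj//] := ltngtP u v.
    by case: (same_side_neighbours ac uv au cu av cv h).
  by case: (same_side_neighbours ac vu av cv au cu (esym h)).
move=> h1 h2 h3 h4 h5 h6.
case b1 : (above_line a c f1); case b2 : (above_line a c f2);
  case b3 : (above_line a c f3).
all: try by constructor 1; apply: same; rewrite ?b1 ?b2.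
all: try by constructor 2; apply: same; rewrite ?b1 ?b3.
all: try by constructor 3; apply: same; rewrite ?b2 ?b3.
Qed.
End Flips.

(** * Convex polygons *)

Section Chain.
Local Open Scope ring_scope.
Variables (R : realType) (n : nat) (X H : 'I_n.+2 -> R) (V : pred 'I_n.+2).
Notation vertex := 'I_n.+2.
(** Heights are kept apart from the points, so that the lower chain can be treated as an upper chain
    with reflected heights. *)
Definition turn (a b c : vertex) : R :=
  (X b - X a) * (H c - H a) - (H b - H a) * (X c - X a).
Hypothesis X_inc : forall i j : vertex, (i < j)%N -> X i < X j.
Hypothesis H_first : H ord0 = 0.
Hypothesis H_last : H ord_max = 0.
Hypothesis V_first : V ord0.
Hypothesis V_last : V ord_max.
Hypothesis H_pos : forall i : vertex, V i -> (0 < i < n.+1)%N -> 0 < H i.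
Definition consecutive (i j : vertex) := [/\ (i < j)%N, V i, V j &
  forall k : vertex, (i < k)%N -> (k < j)%N -> ~~ V k].
Hypothesis one_side : forall i j k l : vertex, consecutive i j ->
  k != i -> k != j -> l != i -> l != j -> 0 < turn i j k * turn i j l.

Lemma consecutive_below (i j k : vertex) : consecutive i j -> (0 < i)%N || (j < n.+1)%N ->
  k != i -> k != j -> turn i j k < 0.
Proof.
move=> cij ends ki kj; have [ij Vi Vj _] := cij.
(* All other vertices are on one side of the line, so one vertex below it suffices; an end vertex of
   the chain will do. *)
suff [w [wi wj w_neg]] : exists w, [/\ w != i, w != j & turn i j w < 0].
  by have := one_side cij ki kj wi wj; rewrite nmulr_lgt0.
have xij := X_inc ij.
have [i0|i0] := posnP i; last first.
  have Hi : 0 < H i by apply: H_pos => //; rewrite i0 (leq_trans ij) // -ltnS ltn_ord.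
  have x0 : X ord0 < X i by apply: X_inc.
  have n0i : ord0 != i by rewrite -val_eqE /= ltn_eqF.
  have n0j : ord0 != j by rewrite -val_eqE /= ltn_eqF // (ltn_trans i0 ij).
  have [jn|jn] := ltnP j n.+1; last first.
    have ej : j = ord_max.
      by apply/val_inj/eqP; rewrite /= eqn_leq jn -ltnS ltn_ord.
    exists ord0; split=> //; rewrite /turn H_first ej H_last.
    have xn : X i < X ord_max by rewrite -ej.
    nra.
  have Hj : 0 < H j by apply: H_pos => //; rewrite (ltn_trans i0 ij).
  have xn : X j < X ord_max by apply: X_inc.
  have nni : ord_max != i by rewrite -val_eqE /= gtn_eqF // (ltn_trans ij jn).
  have nnj : ord_max != j by rewrite -val_eqE /= gtn_eqF.
  have p := one_side cij n0i n0j nni nnj.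
  (* If the first vertex is not below the line, the line is increasing, so it has positive height
     over the last vertex, which is on the axis. *)
  have [t0|t0] := ltP (turn i j ord0) 0; first by exists ord0.
  exists ord_max; split=> //; rewrite /turn H_last.
  have h : 0 <= (H j - H i) * (X i - X ord0) - (X j - X i) * H i.
    by move: t0; rewrite /turn H_first; lra.
  have h2 : 0 < (X j - X i) * H i by apply: mulr_gt0 => //; lra.
  have h3 : 0 < H j - H i.
    have : 0 < (H j - H i) * (X i - X ord0) by lra.
    by rewrite pmulr_lgt0 // subr_gt0.
  have h4 : 0 < (H j - H i) * (X ord_max - X i) by apply: mulr_gt0 => //; lra.
  lra.
have ei : i = ord0 by apply: val_inj.
have jn : (j < n.+1)%N by move: ends; rewrite i0.
have Hj : 0 < H j by apply: H_pos => //; rewrite jn andbT (leq_ltn_trans _ ij).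
have xn : X j < X ord_max by apply: X_inc.
exists ord_max; split.
- by rewrite ei -val_eqE.
- by rewrite -val_eqE /= gtn_eqF.
rewrite /turn ei H_first H_last; rewrite ei in xij.
have : 0 < H j * (X ord_max - X ord0) by apply: mulr_gt0 => //; lra.
lra.
Qed.

(** With [p] and [q] the chain neighbours of [j], the slopes decrease from [ij] through [pj] and
    [jq] to [jk]; only [j] itself has to be on the chain. *)
Lemma turn_neg (i j k : vertex) : V j -> (i < j)%N -> (j < k)%N -> turn i j k < 0.
Proof.
move=> Vj ij jk.
have jn : (j < n.+1)%N by rewrite (leq_trans jk) // -ltnS ltn_ord.
pose P (l : vertex) := V l && (l < j)%N; pose Q (l : vertex) := V l && (j < l)%N.
have P0 : P ord0 by rewrite /P V_first /= (leq_ltn_trans _ ij).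
have Qn : Q ord_max by rewrite /Q V_last.
case: (@arg_maxnP _ ord0 P (@nat_of_ord _) P0) => p /andP[Vp pj] pmax.
case: (@arg_minnP _ ord_max Q (@nat_of_ord _) Qn) => q /andP[Vq qj] qmin.
have cpj : consecutive p j.
  split=> // l pl lj; apply/negP => Vl; have := pmax l.
  by rewrite /P Vl lj => /(_ isT) /=; lia.
have cjq : consecutive j q.
  split=> // l jl lq; apply/negP => Vl; have := qmin l.
  by rewrite /Q Vl jl => /(_ isT) /=; lia.
have ne (u w : vertex) : (u < w)%N -> (u != w) * (w != u).
  by move=> uw; rewrite -!val_eqE ltn_eqF // gtn_eqF.
have Bpj := @consecutive_below p j _ cpj; rewrite jn orbT in Bpj.
have Bjq := @consecutive_below j q _ cjq; rewrite (leq_trans _ pj) // in Bjq.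
have pq := ltn_trans pj qj; have ik := ltn_trans ij jk.
have a1 := X_inc pj; have b1 := X_inc qj; have c1 := X_inc ij; have d1 := X_inc jk.
have h1 : 0 <= (H j - H i) * (X j - X p) - (H j - H p) * (X j - X i).
  have [->|ip] := eqVneq i p; first by lra.
  by have := Bpj i isT ip (ne _ _ ij).1; rewrite /turn; lra.
have h2 : 0 < (H j - H p) * (X q - X j) - (H q - H j) * (X j - X p).
  by have := Bpj q isT (ne _ _ pq).2 (ne _ _ qj).2; rewrite /turn; lra.
have h3 : 0 <= (H q - H j) * (X k - X j) - (H k - H j) * (X q - X j).
  have [->|kq] := eqVneq k q; first by lra.
  by have := Bjq k isT (ne _ _ jk).2 kq; rewrite /turn; lra.
have ab : 0 < (X j - X p) * (X q - X j) by rewrite mulr_gt0 // subr_gt0.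
(* Clearing denominators writes the claim as a positive combination of the three slope
   comparisons. *)
rewrite -oppr_gt0 -(pmulr_lgt0 _ ab).
have -> : - turn i j k * ((X j - X p) * (X q - X j)) =
  ((H j - H i) * (X j - X p) - (H j - H p) * (X j - X i)) * ((X k - X j) * (X q - X j)) +
  ((H j - H p) * (X q - X j) - (H q - H j) * (X j - X p)) * ((X j - X i) * (X k - X j)) +
  ((H q - H j) * (X k - X j) - (H k - H j) * (X q - X j)) * ((X j - X p) * (X j - X i)).
  by rewrite /turn; ring.
apply: ltr_wpDr; last apply: ltr_wpDl.
- by apply: mulr_ge0 => //; apply: mulr_ge0; rewrite subr_ge0 ltW.
- by apply: mulr_ge0 => //; apply: mulr_ge0; rewrite subr_ge0 ltW.
by apply: mulr_gt0 => //; apply: mulr_gt0; rewrite subr_gt0.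
Qed.
End Chain.

Section Polygon.
Local Open Scope ring_scope.
Variables (R : realType) (n : nat) (U : nat -> bool) (v : 'I_n.+2 -> R * R).
Hypothesis vQ : is_Q R n U v.
Notation vertex := 'I_n.+2.
Notation pair := (vertex * vertex)%type.
Implicit Types (d e : pair) (i j k : vertex).

Lemma x_inc i j : (i < j)%N -> (v i).1 < (v j).1.
Proof. by case: vQ => h _ _ _ _; apply: h. Qed.

Lemma orient_up i j k : (i < j)%N -> (j < k)%N -> U j ->
  orient R (v i) (v j) (v k) < 0.
Proof.
case: vQ => hx h0 hn hy hc ij jk Uj.
apply: (@turn_neg R n (fun i => (v i).1) (fun i => (v i).2) (fun i => on_up n U i)) => //.
- exact: h0.
- exact: hn.
- by rewrite /on_up eqxx orbT.
- move=> l; rewrite /on_up => Ul /andP[l0 ln].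
  have l1 : (1 <= l <= n)%N by rewrite l0 -ltnS.
  by have [h _] := hy l l1; apply: h; move: Ul; rewrite gtn_eqF // ltn_eqF.
- move=> a b l m [ab Ua Ub nab] *; apply: hc => //.
  rewrite /adjacent ab Ua Ub /=; apply/orP; left; apply/forallP => o.
  by apply/negP => /and3P[h1 h2]; rewrite (negbTE (nab _ h1 h2)).
by rewrite /on_up Uj !orbT.
Qed.

Lemma orient_down i j k : (i < j)%N -> (j < k)%N -> ~~ U j ->
  0 < orient R (v i) (v j) (v k).
Proof.
case: vQ => hx h0 hn hy hc ij jk Uj.
have oE a b c : turn (fun i => (v i).1) (fun i => - (v i).2) a b c =
    - orient R (v a) (v b) (v c) by rewrite /turn /orient; ring.
rewrite -oppr_lt0 -oE.
apply: (@turn_neg R n _ _ (fun i => on_down n U i)) => //.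
- by rewrite h0 ?oppr0.
- by rewrite hn ?oppr0.
- by rewrite /on_down eqxx orbT.
- move=> l; rewrite /on_down => Ul /andP[l0 ln].
  have l1 : (1 <= l <= n)%N by rewrite l0 -ltnS.
  have [_ h] := hy l l1; rewrite oppr_gt0; apply: h.
  by move: Ul; rewrite gtn_eqF // ltn_eqF.
- move=> a b l m [ab Ua Ub nab] *; rewrite !oE mulrNN; apply: hc => //.
  rewrite /adjacent ab Ua Ub /=; apply/orP; right; apply/forallP => o.
  by apply/negP => /and3P[h1 h2]; rewrite (negbTE (nab _ h1 h2)).
by rewrite /on_down Uj !orbT.
Qed.

(** * Crossing in the plane and crossing of labels *)

Lemma crossC d e : cross R n v d e -> cross R n v e d.
Proof. by case=> t [s [h1 h2 h3 h4]]; exists s, t; split. Qed.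

Lemma orient_cross d e :
  orient R (v d.1) (v d.2) (v e.1) * orient R (v d.1) (v d.2) (v e.2) < 0 ->
  orient R (v e.1) (v e.2) (v d.1) * orient R (v e.1) (v e.2) (v d.2) < 0 ->
  cross R n v d e.
Proof.
set o1 := orient _ _ _ (v e.1); set o2 := orient _ _ _ (v e.2).
set o3 := orient _ _ _ (v d.1); set o4 := orient _ _ _ (v d.2).
move=> h1 h2.
have ratio (a b : R) : a * b < 0 -> a - b != 0 /\ 0 < a / (a - b) < 1.
  move=> ab; have [a0|a0] := ltP 0 a.
    have b0 : b < 0 by rewrite -(pmulr_rlt0 _ a0).
    have d0 : 0 < a - b by lra.
    by rewrite gt_eqF // divr_gt0 //= ltr_pdivrMr // mul1r; split => //; lra.
  have a1 : a < 0.
    by rewrite lt_neqAle a0 andbT; apply: contraTneq ab => ->; rewrite mul0r ltxx.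
  have b0 : 0 < b by rewrite -(nmulr_rlt0 _ a1).
  have d0 : a - b < 0 by lra.
  rewrite lt_eqF // -mulrNN -invrN divr_gt0 ?oppr_gt0 //=.
  by rewrite ltr_pdivrMr ?oppr_gt0 // mul1r; split => //; lra.
have [n1 r1] := ratio _ _ h1; have [n2 r2] := ratio _ _ h2.
(* The orientation relative to one segment is affine along the other; these are the parameters at
   which it vanishes. *)
exists (o3 / (o3 - o4)), (o1 / (o1 - o2)); split=> //;
  move: n1 n2; rewrite /o1 /o2 /o3 /o4 /orient => n1 n2; field; rewrite n1 n2 //.
Qed.

Lemma cross_orient d e : cross R n v d e -> exists2 s : R, 0 < s < 1 &
  (1 - s) * orient R (v d.1) (v d.2) (v e.1) +
  s * orient R (v d.1) (v d.2) (v e.2) = 0.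
Proof.
case=> t [s [_ s01 ex ey]]; exists s => //.
have -> : (1 - s) * orient R (v d.1) (v d.2) (v e.1) +
    s * orient R (v d.1) (v d.2) (v e.2) =
  ((v d.2).1 - (v d.1).1) * (((1 - s) * (v e.1).2 + s * (v e.2).2) - (v d.1).2) -
  ((v d.2).2 - (v d.1).2) * (((1 - s) * (v e.1).1 + s * (v e.2).1) - (v d.1).1).
  by rewrite /orient; ring.
by rewrite -ex -ey; ring.
Qed.

Lemma orient_swap (a b c : R * R) : orient R a c b = - orient R a b c.
Proof. by rewrite /orient; ring. Qed.

Lemma orient_rot (a b c : R * R) : orient R b c a = orient R a b c.
Proof. by rewrite /orient; ring. Qed.

Lemma orient_refl2 (a b : R * R) : orient R a b a = 0.
Proof. by rewrite /orient; ring. Qed.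

Lemma orient_refl1 (a b : R * R) : orient R a b b = 0.
Proof. by rewrite /orient; ring. Qed.

Lemma orient_ne0 i j k : (i < j)%N -> (j < k)%N -> orient R (v i) (v j) (v k) != 0.
Proof.
move=> ij jk; case Uj : (U j); first by rewrite lt_eqF // orient_up.
by rewrite gt_eqF // orient_down // Uj.
Qed.

(** The side of each end point relative to the other segment follows from [orient_up] and
    [orient_down]. Opposite sides give an intersection point; ends of [e] strictly on one side of
    [d] rule it out by [conv]. *)
Lemma crossP d e : (d.1 < d.2)%N -> (e.1 < e.2)%N -> d != e ->
  cross R n v d e <-> crosses U d e.
Proof.
wlog le1 : d e / (d.1 <= e.1)%N.
  move=> wl dd ee de; have [le|/ltnW le] := leqP d.1 e.1; first exact: wl.
  rewrite crossesC -(wl e d) // 1?eq_sym //; split; exact: crossC.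
case: d e le1 => [a c] [b e] /= ab ac be de.
have conv s (o1 o2 : R) : 0 < s < 1 -> (1 - s) * o1 + s * o2 = 0 -> 0 < o1 * o2 -> False.
  move=> /andP[s0 s1] z o12; have [o1p|o1n] := ltP 0 o1.
    have o2p : 0 < o2 by rewrite -(pmulr_rgt0 _ o1p).
    have h1 := mulr_gt0 s0 o2p.
    have h2 : 0 < (1 - s) * o1 by rewrite mulr_gt0 // subr_gt0.
    by lra.
  have o1n' : o1 < 0.
    by rewrite lt_neqAle o1n andbT; apply: contraTneq o12 => ->; rewrite mul0r ltxx.
  have o2n : o2 < 0 by rewrite -(nmulr_rgt0 _ o1n').
  have h1 : s * o2 < 0 by rewrite pmulr_rlt0.
  have h2 : (1 - s) * o1 < 0 by rewrite pmulr_rlt0 // subr_gt0.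
  by lra.
move: ab; rewrite leq_eqVlt => /orP[/eqP/val_inj eab|ab].
  subst b; have nce : c != e by apply: contraNneq de => ->.
  split=> [|]; last by rewrite /crosses /= !ltnn.
  case/cross_orient => s /andP[s0 s1] /=; rewrite orient_refl2 mulr0 add0r.
  move/eqP; rewrite mulf_eq0 (gt_eqF s0) /= => o0.
  have [ce|ec|/val_inj/eqP] := ltngtP c e; last by rewrite (negbTE nce).
    by rewrite (negbTE (orient_ne0 ac ce)) in o0.
  by rewrite orient_swap oppr_eq0 (negbTE (orient_ne0 be ec)) in o0.
have [cb|bc] := leqP c b.
  have -> : crosses U (a, c) (b, e) = false.
    rewrite /crosses /=; have -> : (b < c)%N = false by rewrite ltnNge cb.
    have -> : (b < a)%N = false by rewrite ltnNge ltnW.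
    have -> : (e < c)%N = false by rewrite ltnNge (leq_trans cb (ltnW be)).
    by rewrite /= !andbF.
  split=> //.
  case=> t [s [/andP[t0 t1] /andP[s0 s1] /= ex _]]; exfalso.
  have xac := x_inc ac; have xbe := x_inc be.
  have xcb : (v c).1 <= (v b).1.
    by move: cb; rewrite leq_eqVlt => /orP[/eqP/val_inj->|/x_inc/ltW].
  have h1 : 0 < (1 - t) * ((v c).1 - (v a).1) by rewrite mulr_gt0 // subr_gt0.
  have h2 : 0 < s * ((v e).1 - (v b).1) by rewrite mulr_gt0 // subr_gt0.
  by lra.
have sb : if U b then 0 < orient R (v a) (v c) (v b) else orient R (v a) (v c) (v b) < 0.
  rewrite orient_swap; case Ub : (U b); rewrite ?oppr_gt0 ?oppr_lt0.
    exact: orient_up.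
  by apply: orient_down; rewrite ?Ub.
have sb' : if U b then orient R (v b) (v e) (v a) < 0 else 0 < orient R (v b) (v e) (v a).
  rewrite orient_rot; case Ub : (U b); first exact: orient_up.
  by apply: orient_down; rewrite ?Ub.
have [ce|ec|/val_inj ce] := ltngtP c e.
- have sc : if U c then orient R (v a) (v c) (v e) < 0 else 0 < orient R (v a) (v c) (v e).
    by case Uc : (U c); [exact: orient_up|apply: orient_down; rewrite ?Uc].
  have sc' : if U c then 0 < orient R (v b) (v e) (v c) else orient R (v b) (v e) (v c) < 0.
    rewrite orient_swap; case Uc : (U c); rewrite ?oppr_gt0 ?oppr_lt0.
      exact: orient_up.
    by apply: orient_down; rewrite ?Uc.
  have -> : crosses U (a, c) (b, e) = (U b == U c).
    rewrite /crosses /= ab bc ce /=; have -> : (b < a)%N = false by rewrite ltnNge ltnW.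
    have -> : (e < c)%N = false by rewrite ltnNge ltnW.
    by rewrite /= ?andbF !orbF.
  split=> [/cross_orient[s s01 /= z]|/eqP Ubc].
    apply: contraT => nbc; exfalso; apply: (conv s _ _ s01 z).
    by move: sb sc nbc; case: (U b); case: (U c) => // h1 h2 _;
      [apply: mulr_gt0|rewrite nmulr_lgt0].
  apply: orient_cross => /=; move: sb sb' sc sc'; rewrite Ubc; case: (U c) => *;
    first [by rewrite pmulr_rlt0 | by rewrite nmulr_rlt0].
- have se : if U e then 0 < orient R (v a) (v c) (v e) else orient R (v a) (v c) (v e) < 0.
    rewrite orient_swap; case Ue : (U e); rewrite ?oppr_gt0 ?oppr_lt0.
      by apply: orient_up => //; apply: ltn_trans be.
    by apply: orient_down; rewrite ?Ue // (ltn_trans ab).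
  have se' : if U e then orient R (v b) (v e) (v c) < 0 else 0 < orient R (v b) (v e) (v c).
    by case Ue : (U e); [exact: orient_up|apply: orient_down; rewrite ?Ue].
  have -> : crosses U (a, c) (b, e) = (U b != U e).
    rewrite /crosses /= ab bc ec /=; have -> : (b < a)%N = false by rewrite ltnNge ltnW.
    have -> : (c < e)%N = false by rewrite ltnNge ltnW.
    by rewrite /= !orbF.
  split=> [/cross_orient[s s01 /= z]|Ube].
    apply: contraT; rewrite negbK => /eqP Ube; exfalso; apply: (conv s _ _ s01 z).
    by move: sb se; rewrite Ube; case: (U e) => // h1 h2;
      [apply: mulr_gt0|rewrite nmulr_lgt0].
  apply: orient_cross => /=; move: sb sb' se se' Ube; case: (U b); case: (U e) => // *;
    first [by rewrite pmulr_rlt0 | by rewrite nmulr_rlt0].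
subst e; split=> [/cross_orient[s /andP[s0 s1] /=]|].
  rewrite orient_refl1 mulr0 addr0 => /eqP; rewrite mulf_eq0 subr_eq0 (gt_eqF s1) /=.
  by rewrite orient_swap oppr_eq0 (negbTE (orient_ne0 ab be)).
rewrite /crosses /= !ltnn; have -> : (b < a)%N = false by rewrite ltnNge ltnW.
by rewrite /= !andbF.
Qed.

Lemma is_triangP T : is_triang R n U v T <-> ctriang U T.
Proof.
have K d e : is_diag n U d -> is_diag n U e -> d != e ->
    cross R n v d e <-> crosses U d e.
  by case/is_diagP => dd _ _ /is_diagP[ee _ _]; apply: crossP.
split=> -[dg nc mx].
  split=> // [d e dT eT|d ddg dT].
    have [->|de] := eqVneq d e; first by rewrite crosses_irr.
    by apply/negP => /(K _ _ (dg _ dT) (dg _ eT) de); apply: nc.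
  have [e eT c] := mx d ddg dT; exists e => //.
  by apply/(K _ _ ddg (dg _ eT)) => //; apply: contraNneq dT => ->.
split=> // [d e dT eT de|d ddg dT].
  by move/(K _ _ (dg _ dT) (dg _ eT) de); apply/negP; apply: nc.
have [e eT c] := mx d ddg dT; exists e => //.
by apply/(K _ _ ddg (dg _ eT)) => //; apply: contraNneq dT => ->.
Qed.

Lemma slope_up i j k : (i < j)%N -> (j < k)%N -> U j ->
  slope R n v i k < slope R n v i j /\ slope R n v j k < slope R n v i k.
Proof.
move=> ij jk Uj; have := orient_up ij jk Uj.
have ik := ltn_trans ij jk.
have := x_inc ij; have := x_inc jk; have := x_inc ik; rewrite /orient /slope => xik xjk xij o.
by split; rewrite ltr_pdivrMr ?subr_gt0 // mulrAC ltr_pdivlMr ?subr_gt0 //; lra.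
Qed.

Lemma slope_down i j k : (i < j)%N -> (j < k)%N -> ~~ U j ->
  slope R n v i j < slope R n v i k /\ slope R n v i k < slope R n v j k.
Proof.
move=> ij jk Uj; have := orient_down ij jk Uj.
have ik := ltn_trans ij jk.
have := x_inc ij; have := x_inc jk; have := x_inc ik; rewrite /orient /slope => xik xjk xij o.
by split; rewrite ltr_pdivrMr ?subr_gt0 // mulrAC ltr_pdivlMr ?subr_gt0 //; lra.
Qed.

(** Pass from one diagonal to the other by changing one end at a time; each change raises the
    slope. *)
Lemma slope_quad (l r : vertex) (p q : 'I_n) : (p < q)%N -> (l < p.+1)%N -> (q.+1 < r)%N ->
  slope R n v (quad_a U l p) (quad_c U q r) < slope R n v (quad_b U l p) (quad_e U q r).
Proof.
move=> pq lp qr; rewrite /quad_a /quad_b /quad_c /quad_e.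
have pq' : (vtx p < vtx q)%N by rewrite !vtxE ltnS.
have pr : (vtx p < r)%N by apply: ltn_trans pq' _; rewrite vtxE.
have lp' : (l < vtx p)%N by rewrite vtxE.
have lq : (l < vtx q)%N by apply: ltn_trans pq'.
have qr' : (vtx q < r)%N by rewrite vtxE.
case Up : (U p.+1); case Uq : (U q.+1).
- have [h1 _] := slope_up pq' qr' Uq; have [_ h2] := slope_up lp' pq' Up; exact: lt_trans h1 h2.
- have [h1 _] := slope_down pq' qr' (negbT Uq); have [_ h2] := slope_up lp' pr Up.
  exact: lt_trans h1 h2.
- have [_ h1] := slope_down lp' pr (negbT Up); have [h2 _] := slope_up pq' qr' Uq.
  exact: lt_trans h1 h2.
have [_ h1] := slope_down lp' pq' (negbT Up); have [h2 _] := slope_down pq' qr' (negbT Uq).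
exact: lt_trans h1 h2.
Qed.
End Polygon.

(** * The isomorphism *)

Section Main.
Variables (R : realType) (n : nat) (U : nat -> bool) (v : 'I_n.+2 -> R * R).
Hypothesis vQ : is_Q R n U v.
Notation vertex := 'I_n.+2.
Notation pair := (vertex * vertex)%type.
Implicit Types (x y z : 'S_n) (p q m : 'I_n).
Local Notation tr := (@triang_of n U).

Lemma free_consecutive x (f : pair) p q m : edge U x f ->
  pos x q = (pos x p).+1 -> below_cut U f p -> above_cut U f q ->
  between p m q -> ~~ on_path U x (pos x q) (vtx m).
Proof.
move=> fe e bp aq; have [_ _ _ inner] := edge_path_step e fe bp aq.
have sp : f.1 <= p.+1 <= f.2.
  by apply: (cut_span (U := U)); [rewrite bp|exact: edge_lt fe].
have sq : f.1 <= q.+1 <= f.2.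
  by apply: (cut_span (U := U)); [rewrite aq orbT|exact: edge_lt fe].
rewrite /between => bm; apply: inner; rewrite vtxE; clear -sp sq bm; lia.
Qed.

Lemma cover_up_flip x p q : p < q -> pos x q = (pos x p).+1 ->
  (forall m, between p m q -> ~~ on_path U x (pos x q) (vtx m)) ->
  up_flip R n U v (tr x) (tr (x * tperm p q)%g).
Proof.
move=> pq e free; have [l [r [lp qr sx sy sides]]] := cover_quad pq e free.
have [s1 s2 s3 s4] := quad_spans U pq lp qr.
have [acx _ ->] := cover_triang e sx sy s1 s2 s3 s4.
have [h1 h2 h3 h4] := sides x (or_introl erefl).
exists (quad_a U l p), (quad_c U q r), (quad_b U l p), (quad_e U q r).
split=> //; last exact: (slope_quad vQ).
- by apply/andP; split; [case: sx|case: sy].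
- by rewrite !linkedE h1 h2 h3 h4.
Qed.

(** A path vertex between [p] and [q] is a witness that the cover is contracted; if there is none,
    the cover is a flip. *)
Lemma cover_flip x p q : p < q -> pos x q = (pos x p).+1 ->
  tr (x * tperm p q)%g = tr x \/ up_flip R n U v (tr x) (tr (x * tperm p q)%g).
Proof.
move=> pq e; have [m /andP[bm pm]|no] :=
    pickP (fun m => between p m q && on_path U x (pos x q) (vtx m)).
  left; apply: (witness_swap (b := m)) => //.
  - by move: bm; rewrite /between; clear -pq; lia.
  - by move: bm; rewrite /between; clear -pq; lia.
  have mp : m != p by apply: contraTneq bm => ->; rewrite /between !ltnn andbF.
  have := pos_neq x mp; move: pm; rewrite on_path_vtx e.
  by case: (U _); clear; lia.
right; apply: cover_up_flip => // m bm.
by have := no m; rewrite bm /= => ->.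
Qed.

(** Make the labels [p] and [q] on the two sides of the flipped diagonal consecutive in a
    representative. If [p < q], exchanging them performs the flip; [q < p] contradicts the increase
    of slope. *)
Lemma flip_cover_perm x T' : up_flip R n U v (tr x) T' -> exists x' p q,
  [/\ p < q, pos x' q = (pos x' p).+1, tr x' = tr x & tr (x' * tperm p q)%g = T'].
Proof.
case=> a [c [b [e [acx /andP[ac be]]]]].
rewrite !linkedE => /and4P[ab bc ae ec] T'E sl.
have [p [q [x' [ex' suc bp aq]]]] := make_consecutive acx.
have fe : edge U x' (a, c) by move: acx; rewrite -ex' inE => /andP[].
have sp : a <= p.+1 <= c by apply: (@cut_span n U (a, c)); rewrite ?bp.
have sq : a <= q.+1 <= c by apply: (@cut_span n U (a, c)); rewrite ?aq ?orbT.
have edge_symE z w i j : tr z = tr w -> edge_sym U z i j = edge_sym U w i j.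
  by move=> h; rewrite -!linkedE h.
have conv i j : edge_sym U x' i j -> edge_sym U x i j.
  by rewrite (edge_symE _ _ _ _ ex').
have sy z i j : edge_sym U z i j -> edge_sym U z j i by rewrite /edge_sym orbC.
(* The ends of the flipped diagonal have at most two common neighbours, so the quadrilateral of
   [cover_quad] is that of the given flip. *)
have pair_eq (b' e' : vertex) : b' < e' -> edge_sym U x a b' -> edge_sym U x b' c ->
    edge_sym U x a e' -> edge_sym U x e' c -> b' = b /\ e' = e.
  move=> be' h1 h2 h3 h4.
  have N (f1 f2 f3 : vertex) := @common_neighbours n U x a c f1 f2 f3 ac.
  have lt_ne (i j : vertex) : i < j -> i <> j by move=> ij eij; rewrite eij ltnn in ij.
  have k1 := N b e b' ab (sy _ _ _ bc) ae (sy _ _ _ ec) h1 (sy _ _ _ h2).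
  have k2 := N b e e' ab (sy _ _ _ bc) ae (sy _ _ _ ec) h3 (sy _ _ _ h4).
  have nbe := lt_ne _ _ be; have nbe' := lt_ne _ _ be'.
  case: k1 => [/nbe//|e1|e1]; case: k2 => [/nbe//|e2|e2] //.
  - by case: nbe'; rewrite -e1.
  - by move: be'; rewrite -e1 -e2 ltnNge ltnW.
  - by case: nbe'; rewrite -e1.
have free m : between p m q -> ~~ on_path U x' (pos x' q) (vtx m).
  exact: free_consecutive fe suc bp aq.
have [pq|qp|/val_inj epq] := ltngtP p q; last by move: suc; rewrite epq; clear; lia.
  have [l [r [lp qr sx sy' sides]]] := cover_quad pq suc free.
  have [s1 s2 s3 s4] := quad_spans U pq lp qr.
  have [_ _ trE] := cover_triang suc sx sy' s1 s2 s3 s4.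
  have fq : (quad_a U l p, quad_c U q r) = (a, c).
    apply: (path_step_uniq (u := p.+1) (v := q.+1) sx (edge_path_step suc fe bp aq)) => //=.
    - by case/andP: s1.
    - by case/andP: s2.
    - by case/andP: sp.
    - by case/andP: sq.
  case: fq => fa fc; have [h1 h2 h3 h4] := sides x' (or_introl erefl).
  rewrite fa fc in h1 h2 h3 h4 trE.
  have [eb ee] : quad_b U l p = b /\ quad_e U q r = e.
    by apply: pair_eq; [case: sy'|exact: conv h1|exact: conv h2|
      exact: conv h3|exact: conv h4].
  by exists x', p, q; split=> //; rewrite trE T'E ex' eb ee.
(* Now [x'] covers [y], so [ac] is the steeper diagonal of its quadrilateral, against the hypothesis
   [sl]. *)
set y := (x' * tperm p q)%g.
have yp : pos y p = pos x' q by rewrite pos_swap tpermL.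
have yq : pos y q = pos x' p by rewrite pos_swap tpermR.
have suc' : pos y p = (pos y q).+1 by rewrite yp yq.
have x'E : x' = (y * tperm q p)%g by rewrite tpermC /y -mulgA tperm2 mulg1.
have freey m : between q m p -> ~~ on_path U y (pos y p) (vtx m).
  move=> bm; have bm' : between p m q by rewrite /between orbC.
  have mp : p != m by apply: contraTneq bm => <-; rewrite /between !ltnn andbF.
  have mq : q != m by apply: contraTneq bm => <-; rewrite /between !ltnn andbF.
  by have := free m bm'; rewrite !on_path_vtx yp /y pos_swap tpermD.
have [l [r [lq pr sy' sx sides]]] := cover_quad qp suc' freey.
have [s1 s2 s3 s4] := quad_spans U qp lq pr.
have fq : (quad_b U l q, quad_e U p r) = (a, c).
  rewrite -x'E yp in sx.
  apply: (path_step_uniq (u := q.+1) (v := p.+1) sx (edge_path_step suc fe bp aq)) => //=.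
  - by case/andP: s3.
  - by case/andP: s4.
  - by case/andP: sq.
  - by case/andP: sp.
case: fq => fa fc; have [h1 h2 h3 h4] := sides x' (or_intror x'E).
rewrite fa fc in h1 h2 h3 h4.
have [eb ee] : quad_a U l q = b /\ quad_c U p r = e.
  by apply: pair_eq; [case: sy'|exact: conv (sy _ _ _ h1)|exact: conv h3|
    exact: conv h2|exact: conv (sy _ _ _ h4)].
have := slope_quad vQ qp lq pr; rewrite fa fc eb ee => sl'.
by have := lt_trans sl sl'; rewrite ltxx.
Qed.

(** Descend from [y] to [x] by covers; each is contracted or an upward flip. *)
Lemma weak_le_flip x y : weak_le n x y -> flip_le R n U v (tr x) (tr y).
Proof.
have [k] := ubnP #|inv_set n y|; elim: k y => // k IH y lek xy.
have [<-|ne] := eqVneq x y; first exact: rt_refl.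
have [a [c [ac e nx]]] := exists_descent xy (fun h => negP ne (introT eqP (esym h))).
set z := (y * tperm a c)%g.
have yE : y = (z * tperm a c)%g by rewrite /z -mulgA tperm2 mulg1.
have ez : pos z c = (pos z a).+1 by rewrite !pos_swap tpermL tpermR.
have iy : inv_set n y = (a, c) |: inv_set n z by rewrite {1}yE; apply: inv_swap.
have acz : (a, c) \notin inv_set n z by rewrite inv_setE ez; clear; lia.
have xz : weak_le n x z.
  apply/subsetP => d dx; have := subsetP xy d dx; rewrite iy in_setU1.
  by case/orP => // /eqP ed; rewrite -ed dx in nx.
have le1 : flip_le R n U v (tr x) (tr z).
  by apply: IH xz; move: lek; rewrite iy cardsU1 acz; clear; lia.
have := cover_flip ac ez; rewrite -yE => -[->//|h].
exact: rt_trans le1 (rt_step _ _ _ _ h).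
Qed.

Lemma up_flip_step x T : up_flip R n U v (tr x) T ->
  exists y, tr y = T /\ cambrian_le n U x y.
Proof.
case/flip_cover_perm => x' [p [q [pq e ex <-]]].
exists (x' * tperm p q)%g; split=> //; apply/cambrian_leP.
exists x', (x' * tperm p q)%g; split=> //.
by rewrite /weak_le inv_swap // subsetUr.
Qed.

Lemma flip_le_cambrian x T : flip_le R n U v (tr x) T ->
  exists y, tr y = T /\ cambrian_le n U x y.
Proof.
move=> h; have := clos_rt_rt1n _ _ _ _ h => {}h.
move: h; set S := tr x => h; have : tr x = S by []; clearbody S => xS.
elim: h x xS => {S T} [T|T T1 T2 st _ IH] x xT.
  by exists x; split=> //; apply/cambrian_leP; exists x, x; split=> //; apply: weak_le_refl.
rewrite -xT in st; have [y [yT xy]] := up_flip_step st.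
have [z [zT yz]] := IH y yT; exists z; split=> //.
exact: cambrian_le_trans xy yz.
Qed.

Lemma cambrian_flip_le x y :
  cambrian_le n U x y <-> flip_le R n U v (tr x) (tr y).
Proof.
split=> [/cambrian_leP[x' [y' [-> -> h]]]|h]; first exact: weak_le_flip.
have [z [zy xz]] := flip_le_cambrian h.
apply: cambrian_le_trans xz _; apply/cambrian_leP; exists y, y.
by split=> //; apply: weak_le_refl.
Qed.

Lemma up_flip_neq T T' : up_flip R n U v T T' -> T <> T'.
Proof.
case=> a [c [b [e [acT _ _ T'E sl]]]] TT'.
move: acT; rewrite TT' T'E in_setU in_setD1 in_set1 eqxx /= => /eqP[ab ce].
by move: sl; rewrite ab ce ltxx.
Qed.

(* If z lies between x and y = x s in the quotient and its least            *)
(* representative has the new inversion, then y is the join of that         *)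
(* representative with x, which is congruent to its join with min(x).       *)
Lemma up_flip_cover x T' : up_flip R n U v (tr x) T' ->
  flip_cover R n U v (tr x) T'.
Proof.
move=> fl; split; [exact: rt_step|exact: up_flip_neq fl|move=> T''].
have [x' [p [q [pq e ex yT']]]] := flip_cover_perm fl.
rewrite -ex -yT'; set y := (x' * tperm p q)%g.
have iy : inv_set n y = (p, q) |: inv_set n x' by apply: inv_swap.
move=> /flip_le_cambrian[z [<- /cambrian_leP[x1 [z1 [ex1 ez1 xz1]]]]].
move=> /cambrian_flip_le/cambrian_leP[z2 [y2 [ez2 ey2 zy2]]].
have [xd [exd hx]] := fiber_min U x1; have [zd [ezd hz]] := fiber_min U z2.
have xzd : weak_le n xd zd by apply: hx xz1 _; rewrite ezd -ez2.
have zyd : weak_le n zd y by apply: hz zy2 _; rewrite ey2.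
have [pqz|pqz] := boolP ((p, q) \in inv_set n zd); [right|left].
  have [_ _ _ _ jn] := kernel_congruence n U.
  have e1 : tr x' = tr xd by rewrite exd.
  have j1 : is_join n y x' zd.
    apply: is_join_setU; rewrite iy; apply/eqP; rewrite eqEsubset; apply/andP; split.
      by rewrite subUset sub1set in_setU pqz orbT subsetUl.
    by rewrite subUset subsetUr; move: zyd; rewrite /weak_le iy.
  have j2 : is_join n zd xd zd by apply: is_join_setU; apply/esym/setUidPr.
  by rewrite (jn _ _ _ _ _ e1 j1 j2) ezd.
(* Without the new inversion, [zd] is below [x'] and above the least element of its fibre, hence in
   that fibre. *)
have zx : weak_le n zd x'.
  apply/subsetP => d dz; have := subsetP zyd d dz; rewrite iy in_setU1.
  by case/orP => // /eqP ed; rewrite -ed dz in pqz.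
have e1 : tr xd = tr x' by rewrite exd.
by rewrite ez2 -ezd -e1; apply/esym; apply: (class_anti (x2 := x') (y2 := zd) e1).
Qed.

(** The first flip of a nontrivial chain moves away from [T], so by minimality it already reaches
    [T']. *)
Lemma flip_cover_up_flip T T' : flip_cover R n U v T T' -> up_flip R n U v T T'.
Proof.
case=> le ne min.
case: (clos_rt_rt1n _ _ _ _ le) ne min => [//|T1 T2 st le1 ne min].
have [e1|<- //] := min T1 (rt_step _ _ _ _ st) (clos_rt1n_rt _ _ _ _ le1).
by case: (up_flip_neq st).
Qed.
End Main.

Unset Implicit Arguments.

Local Open Scope ring_scope.

Theorem theorem6p3 (R : realType) (n : nat) (U : nat -> bool)
    (v : 'I_n.+2 -> R * R) :
  is_Q R n U v ->
  exists g : 'S_n -> {set 'I_n.+2 * 'I_n.+2},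
    [/\ (forall x, is_triang R n U v (g x)),
        (forall T, is_triang R n U v T -> exists x, g x = T),
        (forall x y, g x = g y <-> cambrian_cong n U x y),
        (forall x y, cambrian_le n U x y <-> flip_le R n U v (g x) (g y)) &
        (forall T T', is_triang R n U v T -> is_triang R n U v T' ->
           (flip_cover R n U v T T' <-> up_flip R n U v T T'))].
Proof.
move=> vQ.
have surj T : is_triang R n U v T -> exists x, triang_of U x = T.
  by move/(is_triangP vQ)/exists_min => [x [xT _]]; exists x.
exists (@triang_of n U); split=> //.
- by move=> x; apply/(is_triangP vQ); apply: triang_ofP.
- by move=> x y; apply: triang_eqP.
- by move=> x y; apply: cambrian_flip_le.
move=> T T' /surj[x <-] _; split; first exact: flip_cover_up_flip.
exact: up_flip_cover.
Qed.
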